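(* Let $p$ be a prime number not equal to $11$ or $19$. Then $T_{p-1}$ is divisible by $p$ if and only if $p=x^2+11y^2$ for some $x,y\in\mathbb{Z}$.
   Context: $(T_n)_{n\ge 0}$ denotes the Tribonacci sequence, defined by the recurrence $T_{n+3}=T_{n+2}+T_{n+1}+T_n$ for $n\ge 0$ and the initial values $T_0=0$, $T_1=1$, $T_2=1$. *)

(* Defs.v *)
From mathcomp Require Import all_boot all_order all_algebra.

Fixpoint tribonacci (n : nat) : nat :=
  match n with
  | 0 => 0
  | 1 => 1
  | 2 => 1
  | ((m.+1 as m1).+1 as m2).+1 => tribonacci m2 + tribonacci m1 + tribonacci m
  end.

(* Main.v *)
Require Import Defs.
From mathcomp Require Import all_boot all_order all_algebra all_field.
From mathcomp Require Import ring zify.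
Set Implicit Arguments. Unset Strict Implicit. Unset Printing Implicit Defensive.
Import Order.TTheory GRing.Theory Num.Theory.
Local Open Scope ring_scope.

(** The polynomial [f = X^3 - X^2 - X - 1] has discriminant -44. Let [V] be the
    Vandermonde product of its roots [al], [be], [ga] in an algebraic closure
    of F_p. Then [V * T_n] is an alternating combination of the powers
    [al ^ n.+1], [be ^ n.+1], [ga ^ n.+1] ([tribonacci_roots]), so [T_(p-1)]
    modulo [p] only depends on the permutation of the roots by the Frobenius
    map [x |-> x ^ p]. The identity gives 0 and the 3-cycles give 4 or -4; a
    transposition fixing [al] gives a value that vanishes only if [3 * al = 1],
    which forces [p] to divide [27 * f (1/3) = -38]. Away from 2, 3, 11 and 19,
    [p] thus divides [T_(p-1)] exactly when Frobenius fixes all the roots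
    ([trib_dvd_frobenius_fixed]).

    In that case [V] lies in F_p, so -11 is a square modulo [p], and since the
    only reduced forms of discriminant -11 are [x^2 +- x y + 3 y^2] we get
    [4 p = x^2 + 11 y^2] ([norm_form11]). What remains is to show that, given
    such an equation, Frobenius fixes the roots if and only if [y] is even
    ([frobenius_fixed_iff]); this is the statement that the splitting field of
    [f] is the ring class field of Z[sqrt -11]. It is obtained here from cubic
    reciprocity. By Cardano's formulas the Lagrange resolvents of the roots
    have cubes [19 + 3 s sqrt(-3)] and [19 - 3 s sqrt(-3)] where [s^2 = -11],
    so that the question is whether the quotient of these two numbers, raised to
    the power [(p - 1) / 3] or [(p + 1) / 3], is 1 ([frobenius_fixed_symbol]).
    If [m^2 + 11 n^2 = 4 p], one can take [s = m / n], and the quotient becomes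
    [A / conj A] for the Eisenstein integer [A = (19 n + 3 m sqrt(-3)) / 2].
    Reciprocity turns its residue class into the cubic residue symbol [psi (p)]
    of the integer [p] modulo [A] ([cubic_symbol_exists]). Now [A] has norm
    [27 p + 16 n^2], which yields [psi (p) = psi (16 n^2)], and for a prime [r]
    dividing [n], reciprocity used backwards gives [psi (r) = 0] because
    [A = - conj A] modulo [r]. What survives is [6 psi (2)] when [n] is even
    (a factor 2 of [n] being set apart) and [4 psi (2)] when [n] is odd; the
    latter is nontrivial because [A] is then not rational modulo 2
    ([scaled_norm_form_symbol]). Reciprocity needs [A] to be congruent to a
    nonzero rational modulo 3, that is, 3 to divide [m] but not [n]; when 3
    divides [y] instead of [x], this is arranged by multiplying
    [x + y sqrt(-11)] by [sqrt(-11)] ([norm_form_symbol]).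

    Reciprocity itself is proved with Gauss sums [G] that live directly in the
    field of characteristic [r]. For a prime [Pi] of norm [q] one has
    [G^3 = q J], where the Jacobi sum [J] is [Pi] up to sign ([jacobi_prime]),
    while [G ^ r] is computed termwise ([gauss_frobenius]). General Eisenstein
    integers are handled by splitting off primes, by strong induction on the
    norm. *)

(** * Roots of unity *)

Lemma prime_order_prim (K : fieldType) (n : nat) (z : K) :
  prime n -> z ^+ n = 1 -> z != 1 -> n.-primitive_root z.
Proof.
move=> n_pr zn z1; have [|k k_prim kn] := prim_order_exists _ zn.
  exact: prime_gt0.
have k1 : k != 1%N.
  by apply: contraNneq z1 => k1; rewrite -(prim_expr_order k_prim) k1 expr1.
by rewrite -(prime_nt_dvdP n_pr k1 kn).
Qed.

Lemma closed_exists_prim_root (K : closedFieldType) (q : nat) :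
  prime q -> q%:R != 0 :> K -> exists z : K, q.-primitive_root z.
Proof.
move=> q_pr q0; have q1 := prime_gt1 q_pr.
have /closed_rootP[z] : size (\poly_(i < q) (1 : K)) != 1%N.
  by rewrite size_poly_eq ?oner_eq0 // gtn_eqF.
rewrite /root horner_poly; under eq_bigr => i _ do rewrite mul1r.
move=> /eqP z0; exists z; apply: prime_order_prim => //.
  by apply/eqP; rewrite -subr_eq0 subrX1 z0 mulr0.
apply: contra_neq q0 => z1; rewrite -[RHS]z0 z1.
by under eq_bigr => i _ do rewrite expr1n; rewrite sumr_const card_ord.
Qed.

Lemma omega_eq0 (K : fieldType) (w : K) :
  3.-primitive_root w -> 1 + w + w ^+ 2 = 0.
Proof.
move=> w3; have /eqP : (w - 1) * (1 + w + w ^+ 2) = 0.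
  have -> : (w - 1) * (1 + w + w ^+ 2) = w ^+ 3 - 1 by ring.
  by rewrite (prim_expr_order w3) subrr.
rewrite mulf_eq0 subr_eq0 => /orP[/eqP w1|/eqP//].
by have := eq_prim_root_expr w3 1 0; rewrite w1 !expr1n eqxx.
Qed.

Lemma omega_prim (K : fieldType) (w : K) :
  3%:R != 0 :> K -> 1 + w + w ^+ 2 = 0 -> 3.-primitive_root w.
Proof.
move=> n3 w0; apply: prime_order_prim => //.
  apply/eqP; rewrite -subr_eq0; apply/eqP.
  have -> : w ^+ 3 - 1 = (w - 1) * (1 + w + w ^+ 2) by ring.
  by rewrite w0 mulr0.
by apply: contra_neq n3 => w1; rewrite -w0 w1; ring.
Qed.

Lemma omega_neq0 (K : fieldType) (w : K) : 3.-primitive_root w -> w != 0.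
Proof.
move=> w3; apply/eqP=> w0; have := prim_expr_order w3.
by rewrite w0 expr0n => /esym/eqP; rewrite oner_eq0.
Qed.

Lemma omega_sqr_prim (K : fieldType) (w : K) :
  3.-primitive_root w -> 3.-primitive_root (w ^+ 2).
Proof. by move=> w3; rewrite prim_root_exp_coprime. Qed.

Lemma omega_sqr_sqr (K : fieldType) (w : K) :
  3.-primitive_root w -> (w ^+ 2) ^+ 2 = w.
Proof. by move=> w3; rewrite -exprM -(prim_expr_mod w3) expr1. Qed.

Lemma cube_root1_omega (K : fieldType) (w x : K) :
  3.-primitive_root w -> x ^+ 3 = 1 -> [\/ x = 1, x = w | x = w ^+ 2].
Proof.
move=> w3 x3; have [i ->] := prim_rootP w3 x3; case: i => [[|[|[|//]]] ?] /=.
- by apply: Or31; rewrite expr0.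
- by apply: Or32; rewrite expr1.
- by apply: Or33.
Qed.

Lemma omega_expr_1mod3 (K : fieldType) (w : K) (p e : nat) :
  3.-primitive_root w -> p = (3 * e).+1 -> w ^+ p = w.
Proof. by move=> w3 ->; rewrite exprS exprM (prim_expr_order w3) expr1n mulr1. Qed.

Lemma omega_expr_2mod3 (K : fieldType) (w : K) (p e : nat) :
  3.-primitive_root w -> p.+1 = (3 * e)%N -> w ^+ p = w ^+ 2.
Proof.
move=> w3 p_eq; apply: (mulfI (omega_neq0 w3)); rewrite -!exprS p_eq exprM.
by rewrite (prim_expr_order w3) expr1n.
Qed.

Lemma prime_mod3 (p : nat) : prime p -> p != 3%N -> exists e,
  (p.+1 %/ 3 = e)%N /\ (p = (3 * e).+1 \/ p.+1 = (3 * e)%N).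
Proof.
move=> p_pr p3; have : ~~ (3 %| p)%N by rewrite dvdn_prime2 // eq_sym.
by clear; exists (p.+1 %/ 3)%N; lia.
Qed.

(** * Cubic characters and Gauss sums over a prime field *)

(** The bound [m < q.-1] is what makes [x ^+ m] a nontrivial character. *)
Lemma cubic_index_bounds (q m : nat) :
  prime q -> q = (3 * m).+1 -> (0 < m < q.-1)%N.
Proof.
move=> q_pr q_eq; case: (posnP m) => m0; first by move: q_pr; rewrite q_eq m0.
by rewrite q_eq; lia.
Qed.

Section CubicCharacter.

Variables (q m : nat) (g : 'F_q).
Hypotheses (q_pr : prime q) (q_eq : q = (3 * m).+1) (g3 : 3.-primitive_root g).

Lemma Fq_char : q \in [pchar 'F_q]. Proof. exact: pchar_Fp. Qed.

Lemma Fq_exists_expr_neq1 (i : nat) :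
  (0 < i < q.-1)%N -> exists2 y : 'F_q, y != 0 & y ^+ i != 1.
Proof.
move=> /andP[i_gt0 i_lt]; apply/exists_inP; apply: contraLR i_lt.
rewrite negb_exists_in => /forall_inP y1; rewrite -leqNgt -ltnS.
have := @max_poly_roots _ ('X^i - 1%:P : {poly 'F_q}) (enum (predC1 (0 : 'F_q))).
rewrite size_XnsubC // -cardE cardC1 card_Fp // => -> //.
- by rewrite -size_poly_gt0 size_XnsubC.
- apply/allP=> y; rewrite mem_enum inE => /y1; rewrite negbK => /eqP y_i.
  by rewrite /root !hornerE y_i subrr.
- exact: enum_uniq.
Qed.

(** Multiplying the summation variable by some [y] with [y ^+ i != 1] scales the
    sum by [y ^+ i]. *)
Lemma Fq_sum_expr (i : nat) : (i < q.-1)%N -> \sum_(x : 'F_q) x ^+ i = 0.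
Proof.
case: i => [|i] i_lt.
  rewrite (eq_bigr (fun=> 1)) ?sumr_const ?card_Fp ?(pcharf0 Fq_char) //.
have [y y0 yi] := @Fq_exists_expr_neq1 i.+1 i_lt.
set S := \sum_x _; have S_eq : S = y ^+ i.+1 * S.
  rewrite {1}/S (reindex_inj (mulfI y0)) mulr_sumr.
  by apply: eq_bigr => x _; rewrite exprMn.
apply/eqP; move/eqP: S_eq; rewrite -subr_eq0 -{1}[S]mul1r -mulrBl mulf_eq0.
by rewrite subr_eq0 eq_sym (negPf yi).
Qed.

Lemma Fq_expr_order (x : 'F_q) : x != 0 -> x ^+ (3 * m) = 1.
Proof.
move=> x0; apply: (mulfI x0); rewrite -exprS -q_eq mulr1.
by have := expf_card x; rewrite card_Fp.
Qed.

(** The cubic index: a discrete logarithm of [x ^+ m] in base the cube root of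
    unity [g]. The choice of [g] amounts to the choice of a prime of Z[omega]
    above [q]; the value at 0 is meaningless. *)
Definition cubind (x : 'F_q) : nat :=
  if x ^+ m == 1 then 0 else if x ^+ m == g then 1 else 2.

Lemma cubindE (x : 'F_q) : x != 0 -> x ^+ m = g ^+ cubind x.
Proof.
move=> x0; have x3 : (x ^+ m) ^+ 3 = 1 by rewrite -exprM mulnC Fq_expr_order.
rewrite /cubind; have := cube_root1_omega g3 x3.
case: eqP => [->//|x1]; case: eqP => [->//|xg].
by case.
Qed.

Lemma cubindM (x y : 'F_q) : x != 0 -> y != 0 ->
  cubind (x * y) = cubind x + cubind y %[mod 3].
Proof.
move=> x0 y0; apply/eqP; rewrite -(eq_prim_root_expr g3) exprD.
by rewrite -!cubindE ?mulf_neq0 // exprMn.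
Qed.

Lemma cubind1 : cubind 1 = 0%N.
Proof. by rewrite /cubind expr1n eqxx. Qed.

Lemma cubindV (x : 'F_q) : x != 0 -> cubind x^-1 + cubind x = 0 %[mod 3].
Proof. by move=> x0; rewrite -cubindM ?invr_neq0 // mulVf // cubind1. Qed.

Lemma cubindN (x : 'F_q) : x != 0 -> cubind (- x) = cubind x %[mod 3].
Proof.
move=> x0; have N1 : (-1 : 'F_q) != 0 by rewrite oppr_eq0 oner_eq0.
have := cubindM N1 N1; rewrite mulrNN mulr1 cubind1 => N0.
have := cubindM N1 x0.
by rewrite mulN1r; move: N0; clear; lia.
Qed.

Section Character.

Variables (K : fieldType) (w : K).

(** The cubic residue character with values in an arbitrary field: [w] stands
    for [omega], and [w ^+ 2] yields the conjugate character. *)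
Definition cubchar (x : 'F_q) : K := if x == 0 then 0 else w ^+ cubind x.

Definition jacobi : K := \sum_x cubchar x * cubchar (1 - x).

Hypothesis w3 : 3.-primitive_root w.

Lemma cubchar0 : cubchar 0 = 0. Proof. by rewrite /cubchar eqxx. Qed.

Lemma cubcharE x : x != 0 -> cubchar x = w ^+ cubind x.
Proof. by rewrite /cubchar => /negPf->. Qed.

Lemma cubchar1 : cubchar 1 = 1.
Proof. by rewrite cubcharE ?oner_eq0 // cubind1. Qed.

Lemma cubcharM x y : cubchar (x * y) = cubchar x * cubchar y.
Proof.
rewrite {1}/cubchar mulf_eq0.
have [->|x0] := eqVneq x 0; first by rewrite /= cubchar0 mul0r.
have [->|y0] := eqVneq y 0; first by rewrite orbT cubchar0 mulr0.
rewrite /= !cubcharE // -exprD; apply/eqP.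
by rewrite (eq_prim_root_expr w3) cubindM.
Qed.

Lemma cubcharN x : cubchar (- x) = cubchar x.
Proof.
have [->|x0] := eqVneq x 0; first by rewrite oppr0.
rewrite !cubcharE ?oppr_eq0 //; apply/eqP.
by rewrite (eq_prim_root_expr w3) cubindN.
Qed.

Lemma sum_cubchar : \sum_x cubchar x = 0.
Proof.
have [y y0 ym] := Fq_exists_expr_neq1 (cubic_index_bounds q_pr q_eq).
have wy : cubchar y != 1.
  rewrite cubcharE // -(expr0 w) (eq_prim_root_expr w3).
  by rewrite -(eq_prim_root_expr g3) -cubindE.
set S := \sum_x _; have S_eq : S = cubchar y * S.
  rewrite {1}/S (reindex_inj (mulfI y0)) mulr_sumr.
  by apply: eq_bigr => x _; rewrite cubcharM.
apply/eqP; move/eqP: S_eq; rewrite -subr_eq0 -{1}[S]mul1r -mulrBl mulf_eq0.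
by rewrite subr_eq0 eq_sym (negPf wy).
Qed.

End Character.

Lemma cubchar_mul_sqr (K : fieldType) (w : K) (x : 'F_q) : 3.-primitive_root w ->
  x != 0 -> cubchar w x * cubchar (w ^+ 2) x = 1.
Proof.
move=> w3 x0; rewrite !cubcharE // -exprM -exprD -mulSn mulnC exprM.
by rewrite exprAC (prim_expr_order w3) expr1n.
Qed.

Section AdditiveCharacter.

Variables (K : fieldType) (z : K).

Definition addchar (x : 'F_q) : K := z ^+ (x : nat).

Definition gauss (w : K) : K := \sum_x cubchar w x * addchar x.

Hypothesis zq : q.-primitive_root z.

Lemma addcharD x y : addchar (x + y) = addchar x * addchar y.
Proof.
rewrite /addchar -exprD; apply/eqP; rewrite (eq_prim_root_expr zq) /=.
by rewrite [X in ((_ %% X) %% _)%N]Fp_cast // modn_mod.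
Qed.

Lemma addchar0 : addchar 0 = 1. Proof. by rewrite /addchar expr0. Qed.

Lemma addchar_natr (n : nat) : addchar n%:R = z ^+ n.
Proof.
by apply/eqP; rewrite (eq_prim_root_expr zq) val_Fp_nat // modn_mod.
Qed.

Lemma sum_addchar (t : 'F_q) : t != 0 -> \sum_x addchar (t * x) = 0.
Proof.
move=> t0; transitivity (\sum_x addchar x).
  by rewrite [RHS](reindex_inj (mulfI t0)).
have z1 : addchar 1 != 1.
  rewrite (addchar_natr 1 : addchar 1 = _) -(expr0 z) (eq_prim_root_expr zq).
  by rewrite mod0n modn_small // prime_gt1.
set S := \sum_x _; have S_eq : S = addchar 1 * S.
  rewrite {1}/S (reindex_inj (addrI 1)) mulr_sumr.
  by apply: eq_bigr => x _; rewrite addcharD.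
apply/eqP; move/eqP: S_eq; rewrite -subr_eq0 -{1}[S]mul1r -mulrBl mulf_eq0.
by rewrite subr_eq0 eq_sym (negPf z1).
Qed.

(** Group the terms of the double sum by [t = x + y]. The terms with [t = 0]
    cancel; rescaling [x] by [t] turns each other group into a Jacobi sum. *)
Lemma gauss_sqr (w : K) : 3.-primitive_root w ->
  gauss w ^+ 2 = jacobi w * gauss (w ^+ 2).
Proof.
move=> w3; have w23 := omega_sqr_prim w3.
have -> : gauss w ^+ 2 =
    \sum_t addchar t * \sum_x cubchar w x * cubchar w (t - x).
  transitivity (\sum_x \sum_t addchar t * (cubchar w x * cubchar w (t - x))).
    rewrite expr2 {1}/gauss mulr_suml; apply: eq_bigr => x _.
    rewrite /gauss mulr_sumr (reindex_inj (addIr (- x))) /=.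
    apply: eq_bigr => t _.
    by rewrite mulrACA -addcharD [x + _]addrC subrK mulrC.
  by rewrite exchange_big /=; apply: eq_bigr => t _; rewrite mulr_sumr.
rewrite (bigD1 0) //= [X in _ * X](_ : _ = 0) ?mulr0 ?add0r; last first.
  rewrite -[RHS](sum_cubchar w23); apply: eq_bigr => x _.
  rewrite sub0r cubcharN //.
  have [->|x0] := eqVneq x 0; first by rewrite !cubchar0 mulr0.
  by rewrite !cubcharE // -expr2 exprAC.
rewrite /gauss [in RHS](bigD1 0) //= cubchar0 mul0r add0r mulr_sumr.
apply: eq_bigr => t t0; rewrite mulrA [RHS]mulrC; congr (_ * _).
rewrite (reindex_inj (mulfI t0)) /jacobi mulr_suml; apply: eq_bigr => x _.
rewrite (_ : t - t * x = t * (1 - x)); last by rewrite mulrBr mulr1.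
rewrite !cubcharM // mulrACA mulrC; congr (_ * _).
by rewrite !cubcharE // -expr2 exprAC.
Qed.

(** Setting [x := x * y] in the double sum isolates a complete sum of the
    additive character, which is nonzero only for [x = -1]. *)
Lemma gauss_mul_conj (w : K) : 3.-primitive_root w ->
  gauss w * gauss (w ^+ 2) = q%:R.
Proof.
move=> w3; have w23 := omega_sqr_prim w3.
have -> : gauss w * gauss (w ^+ 2) =
    \sum_x cubchar w x * \sum_(y | y != 0) addchar ((x + 1) * y).
  rewrite {2}/gauss mulr_sumr (bigD1 0) //= cubchar0 mul0r mulr0 add0r.
  under [RHS]eq_bigr => x _ do rewrite mulr_sumr.
  transitivity (\sum_(y | y != 0) \sum_x cubchar w x * addchar ((x + 1) * y)).
    2: by rewrite [LHS]exchange_big.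
  apply: eq_bigr => y y0.
  rewrite {1}/gauss mulr_suml (reindex_inj (mulIf y0)).
  apply: eq_bigr => x _; rewrite cubcharM // mulrDl mul1r addcharD.
  transitivity (cubchar w x * (addchar (x * y) * addchar y) *
    (cubchar w y * cubchar (w ^+ 2) y)); first by ring.
  by rewrite cubchar_mul_sqr // mulr1.
have sum0 (t : 'F_q) : \sum_(y | y != 0) addchar (t * y) =
    if t == 0 then q%:R - 1 else - 1.
  have := erefl (\sum_y addchar (t * y)).
  rewrite [in RHS](bigD1 0) //= mulr0 addchar0.
  have [->|t0] := eqVneq t 0.
    under eq_bigr => y _ do rewrite mul0r addchar0.
    by rewrite sumr_const card_Fp // => ->; ring.
  by rewrite sum_addchar // => /eqP; rewrite eq_sym addrC addr_eq0 => /eqP.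
under eq_bigr => x _ do rewrite sum0.
transitivity (\sum_x (- cubchar w x + if x == - 1 then q%:R else 0)).
  apply: eq_bigr => x _; rewrite addr_eq0; case: eqP => [->|_]; last by ring.
  by rewrite cubcharN // cubchar1; ring.
rewrite big_split /= sumrN sum_cubchar // oppr0 add0r.
by rewrite -big_mkcond big_pred1_eq.
Qed.

End AdditiveCharacter.
End CubicCharacter.

(** * Eisenstein integers and the cubic Jacobi sum *)

(** An Eisenstein integer is given by its coordinates on [1], [omega] and is
    used through its images in fields of all characteristics, [w] being the
    image of [omega]; the image of the conjugate is the value at [w ^+ 2]. *)
Definition eis (K : pzRingType) (w : K) (a b : int) : K := a%:~R + b%:~R * w.

Lemma eis_conj_mul (K : fieldType) (w : K) (a b : int) : 3.-primitive_root w ->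
  eis w a b * eis (w ^+ 2) a b = (a ^+ 2 - a * b + b ^+ 2)%:~R.
Proof.
move=> w3; rewrite /eis !rmorphD rmorphN !rmorphXn rmorphM /=.
set x := a%:~R; set y := b%:~R.
have -> : (x + y * w) * (x + y * w ^+ 2) =
    x ^+ 2 + x * y * (1 + w + w ^+ 2) - x * y + y ^+ 2 * w ^+ 3 by ring.
by rewrite omega_eq0 // (prim_expr_order w3); ring.
Qed.

Lemma eisM (K : fieldType) (w : K) (a b c d : int) : 3.-primitive_root w ->
  eis w (a * c - b * d) (a * d + b * c - b * d) = eis w a b * eis w c d.
Proof.
move=> w3; rewrite /eis !rmorphD !rmorphN !rmorphM /=.
set x := a%:~R; set y := b%:~R; set u := c%:~R; set v := d%:~R.
apply/eqP; rewrite -subr_eq0; apply/eqP.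
transitivity (- (y * v * (1 + w + w ^+ 2))); first by ring.
by rewrite omega_eq0 // mulr0 oppr0.
Qed.

Definition omega_re (n : nat) : int := [:: 1; 0; -1]`_(n %% 3).
Definition omega_im (n : nat) : int := [:: 0; 1; -1]`_(n %% 3).

Lemma omega_expr_eis (K : fieldType) (w : K) (n : nat) : 3.-primitive_root w ->
  w ^+ n = eis w (omega_re n) (omega_im n).
Proof.
move=> w3; rewrite -(prim_expr_mod w3) /omega_re /omega_im.
have : (n %% 3 < 3)%N by rewrite ltn_mod.
case: (n %% 3)%N => [|[|[|//]]] _; rewrite /eis /=; [by ring | by ring |].
have -> : w ^+ 2 = (1 + w + w ^+ 2) - 1 - w by ring.
by rewrite omega_eq0 //; ring.
Qed.

Lemma omega_im_mod3 (n : nat) : (omega_im n)%:~R = n%:R :> 'F_3.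
Proof.
rewrite -(Fp_nat_mod (isT : prime 3) n) /omega_im.
have : (n %% 3 < 3)%N by rewrite ltn_mod.
by case: (n %% 3)%N => [|[|[|//]]] _; apply/val_inj.
Qed.

Section JacobiPrime.

Variables (q m : nat) (g : 'F_q).
Hypotheses (q_pr : prime q) (q_eq : q = (3 * m).+1) (g3 : 3.-primitive_root g).

Let cub := cubind m g.

Lemma jacobiE (K : fieldType) (w : K) :
  jacobi m g w = \sum_(x | (x != 0) && (x != 1)) w ^+ (cub x + cub (1 - x)).
Proof.
rewrite /jacobi [RHS]big_mkcond; apply: eq_bigr => x _.
rewrite /cubchar subr_eq0 [1 == x]eq_sym.
case: (x == 0); first by rewrite mul0r.
by case: (x == 1); rewrite ?mulr0 //= exprD.
Qed.

(** For the residue field valued character [x |-> x ^+ m], the Jacobi sum is a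
    sum of values of a polynomial of degree [2 * m < q.-1]. This is the
    divisibility of the Jacobi sum by the prime defining the character. *)
Lemma jacobi_Fq : jacobi m g g = 0.
Proof.
have /andP[m_gt0 _] := cubic_index_bounds q_pr q_eq.
transitivity (\sum_(x : 'F_q) (x - x ^+ 2) ^+ m).
  rewrite jacobiE [LHS]big_mkcond; apply: eq_bigr => x _.
  have -> : x - x ^+ 2 = x * (1 - x) by ring.
  have [->|x0] := eqVneq x 0; first by rewrite mul0r expr0n gtn_eqF.
  have [->|x1] := eqVneq x 1; first by rewrite subrr mulr0 expr0n gtn_eqF.
  have x1' : 1 - x != 0 by rewrite subr_eq0 eq_sym.
  by rewrite /= exprD exprMn !(cubindE q_pr q_eq g3).
under eq_bigr => x _ do rewrite exprBn.
rewrite exchange_big /= big1 // => i _; rewrite sumrMnl.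
under eq_bigr => x _ do rewrite -exprM -mulrA -exprD.
rewrite -mulr_sumr (Fq_sum_expr q_pr) ?mulr0 ?mul0rn //.
by rewrite q_eq /=; have := ltn_ord i; lia.
Qed.

(** Up to the automorphism [x |-> 1 - x], this is twice the sum of all the
    indices, which vanishes by pairing [x] with its inverse. *)
Lemma sum_cubind_mod3 :
  \sum_(x | (x != 0) && (x != 1)) (cub x + cub (1 - x))%:R = 0 :> 'F_3.
Proof.
under eq_bigr => x _ do rewrite natrD.
rewrite big_split /=.
set S := \sum_(x | _) (cub x)%:R; set S' := \sum_(x | _) _.
have -> : S' = S.
  rewrite /S' (reindex_inj (inv_inj (subKr 1))) /=.
  apply: eq_big => [x|x _]; last by rewrite subKr.
  by rewrite subr_eq0 eq_sym andbC; congr (_ && ~~ _);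
     rewrite -subr_eq0 addrAC subrr sub0r oppr_eq0.
have -> : S = \sum_(x : 'F_q | x != 0) (cub x)%:R.
  by rewrite [RHS](bigD1 1) ?oner_eq0 //= /cub cubind1 add0r.
rewrite {2}(reindex_inj invr_inj) /=.
under [X in _ + X]eq_bigl => x do rewrite invr_eq0.
rewrite -big_split big1 //= => x x0; rewrite -natrD -(Fp_nat_mod (isT : prime 3)).
by rewrite addnC (cubindV q_pr q_eq g3) // mod0n.
Qed.

(** The coordinates are the same in all characteristics. Modulo 3 the second one
    is the sum of the exponents, hence 0; the norm is computed with Gauss sums
    over the complex algebraic numbers. *)
Lemma jacobi_eis : exists a b : int, [/\ (3 %| b)%Z,
  forall (K : fieldType) (w : K), 3.-primitive_root w -> jacobi m g w = eis w a b
  & a ^+ 2 - a * b + b ^+ 2 = q%:Z].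
Proof.
pose a := \sum_(x : 'F_q | (x != 0) && (x != 1)) omega_re (cub x + cub (1 - x)).
pose b := \sum_(x : 'F_q | (x != 0) && (x != 1)) omega_im (cub x + cub (1 - x)).
have jE (K : fieldType) (w : K) : 3.-primitive_root w ->
    jacobi m g w = eis w a b.
  move=> w3; rewrite jacobiE /eis !rmorph_sum mulr_suml -big_split /=.
  by apply: eq_bigr => x _; rewrite (omega_expr_eis _ w3).
exists a, b; split=> //.
  rewrite (dvdz_pcharf (pchar_Fp (isT : prime 3))) rmorph_sum /=.
  by under eq_bigr => x _ do rewrite omega_im_mod3; rewrite sum_cubind_mod3.
have [z zq] := C_prim_root_exists (prime_gt0 q_pr).
have [w w3] := C_prim_root_exists (isT : (0 < 3)%N).
have w23 := omega_sqr_prim w3.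
apply: (@intr_inj algC); rewrite -(eis_conj_mul _ _ w3) -!jE //.
have q0 : q%:R != 0 :> algC by rewrite pnatr_eq0 -lt0n prime_gt0.
apply: (mulIf q0); rewrite -(gauss_mul_conj q_pr q_eq g3 zq w3).
have Gw := gauss_sqr q_pr q_eq g3 zq w3.
have Gw2 := gauss_sqr q_pr q_eq g3 zq w23.
rewrite omega_sqr_sqr // in Gw2.
set G := gauss _ _ _ w; set G' := gauss _ _ _ (w ^+ 2).
transitivity ((jacobi m g w * G') * (jacobi m g (w ^+ 2) * G)); first by ring.
rewrite -Gw -Gw2 -/G -/G'.
have -> : G ^+ 2 * G' ^+ 2 = (G * G') * (G * G') by ring.
by rewrite {1}/G {1}/G' (gauss_mul_conj q_pr q_eq g3 zq w3).
Qed.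

(** Both the Jacobi sum and [c + d * omega] have norm [q] and belong to the
    prime ideal of [g], so they differ by a unit; the congruences modulo 3
    leave only the units 1 and -1. *)
Lemma jacobi_prime (c d : int) : c ^+ 2 - c * d + d ^+ 2 = q%:Z -> (3 %| d)%Z ->
  eis g c d = 0 -> exists s : bool,
  forall (K : fieldType) (w : K), 3.-primitive_root w ->
  jacobi m g w = (-1) ^+ s * eis w c d.
Proof.
have [a [b [b3 jE ab_q]]] := jacobi_eis.
move=> cd_q d3 g_cd; have g_ab : eis g a b = 0 by rewrite -jE // jacobi_Fq.
(* [x' + y * q * omega] is [J] times the conjugate of [c + d * omega]; it has
   norm [q ^ 2] and both coordinates are divisible by [q]. *)
have /dvdzP[y y_eq] : (q %| b * c - a * d)%Z.
  rewrite (dvdz_pcharf (Fq_char q_pr)) rmorphB !rmorphM /=.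
  move/eqP: g_cd; move/eqP: g_ab; rewrite /eis !addr_eq0 => /eqP-> /eqP->.
  by apply/eqP; ring.
have q_gt0 := prime_gt0 q_pr.
pose x' := a * c - a * d + b * d.
have N_eq : x' ^+ 2 - x' * (y * q) + (y * q) ^+ 2 = (q%:Z) ^+ 2.
  rewrite -y_eq /x' [RHS]expr2 -[X in _ = X * _]ab_q -[X in _ = _ * X]cd_q; ring.
have /dvdzP[x x_eq] : (q %| x')%Z.
  have : (q %| x' ^+ 2)%Z.
    apply/dvdzP; exists (q%:Z + x' * y - y ^+ 2 * q%:Z).
    by rewrite mulrBl mulrDl -[q%:Z * q%:Z]expr2 -N_eq; ring.
  by rewrite !dvdzE abszX Euclid_dvdX // => /andP[].
have y3 : (3 %| y)%Z.
  have : (3 %| y * q)%Z.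
    by rewrite -y_eq rpredB //; [apply: dvdz_mulr | apply: dvdz_mull].
  rewrite Gauss_dvdzl // coprimezE /= prime_coprime // q_eq -[(3 * m).+1]addn1.
  by rewrite dvdn_addr ?dvdn_mulr.
have xy1 : x ^+ 2 - x * y + y ^+ 2 = 1.
  have q2 : (q%:Z) ^+ 2 != 0 by rewrite sqrf_eq0 eqz_nat -lt0n.
  by apply: (mulIf q2); rewrite mul1r -[RHS]N_eq x_eq; ring.
have y0 : y = 0.
  move/dvdzP: y3 xy1 => [t ->] xt.
  have [->|t0] := eqVneq t 0; first by rewrite mul0r.
  have t1 : 0 < t ^+ 2 by rewrite exprn_even_gt0.
  have : (2 * x - 3 * t) ^+ 2 + 27 * t ^+ 2 = 4.
    by rewrite -[RHS](mulr1 4) -[X in _ = _ * X]xt; ring.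
  by have := sqr_ge0 (2 * x - 3 * t); clear -t1; lia.
have x1 : x = 1 \/ x = -1.
  have /eqP : x ^+ 2 = 1 by rewrite -[RHS]xy1 y0; ring.
  rewrite sqrf_eq1.
  by case/orP=> /eqP; [left | right].
have [aE bE] : a = x * c /\ b = x * d.
  have q0 : q%:Z != 0 by rewrite eqz_nat -lt0n.
  move: x_eq; rewrite /x' => x_eq; move: y_eq; rewrite y0 mul0r => y_eq.
  split; apply: (mulIf q0).
    rewrite mulrAC -x_eq -cd_q; apply/eqP; rewrite -subr_eq0; apply/eqP.
    by transitivity (- d * (b * c - a * d)); [ring | rewrite y_eq mulr0].
  rewrite mulrAC -x_eq -cd_q; apply/eqP; rewrite -subr_eq0; apply/eqP.
  by transitivity ((c - d) * (b * c - a * d)); [ring | rewrite y_eq mulr0].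
exists (x == -1) => K w w3; rewrite jE // aE bE.
by case: x1 => ->; rewrite /eis !rmorphM /=; ring.
Qed.

End JacobiPrime.

(** * Cubic reciprocity for a prime of degree one *)

Section PrimeReciprocity.

Variables (q m : nat) (g : 'F_q).
Hypotheses (q_pr : prime q) (q_eq : q = (3 * m).+1) (g3 : 3.-primitive_root g).

Lemma gauss_cube (K : fieldType) (w z : K) :
  3.-primitive_root w -> q.-primitive_root z ->
  gauss m g z w ^+ 3 = q%:R * jacobi m g w.
Proof.
move=> w3 zq; rewrite exprS (gauss_sqr q_pr q_eq g3 zq w3) mulrCA mulrC.
by rewrite (gauss_mul_conj q_pr q_eq g3 zq w3).
Qed.

Lemma gauss_neq0 (K : fieldType) (w z : K) :
  3.-primitive_root w -> q.-primitive_root z -> gauss m g z w != 0.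
Proof.
move=> w3 zq; have := prim_root_natf_neq0 zq.
rewrite -(gauss_mul_conj q_pr q_eq g3 zq w3); apply: contraNneq => ->.
by rewrite mul0r.
Qed.

(** Frobenius acts on the values of both characters; the substitution
    [x |-> r * x] brings the additive character back to its original form. *)
Lemma gauss_frobenius (K : fieldType) (w z : K) (r : nat) :
  3.-primitive_root w -> q.-primitive_root z -> r \in [pchar K] -> r != 3%N ->
  r%:R != 0 :> 'F_q ->
  (w ^+ r) ^+ cubind m g r%:R * gauss m g z w ^+ r = gauss m g z (w ^+ r).
Proof.
move=> w3 zq r_char r3 r0; have r_pr := pcharf_prime r_char.
have wr3 : 3.-primitive_root (w ^+ r).
  by rewrite prim_root_exp_coprime // prime_coprime // dvdn_prime2.
rewrite -(cubcharE _ _ _ r0) -[gauss m g z w ^+ r](pFrobenius_autE r_char).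
rewrite {1}/gauss rmorph_sum mulr_sumr [RHS](reindex_inj (mulfI r0)) /=.
apply: eq_bigr => x _.
rewrite pFrobenius_autE exprMn (cubcharM q_pr q_eq g3) // -mulrA.
congr (_ * (_ * _)).
  have [->|x0] := eqVneq x 0.
    by rewrite !cubchar0 expr0n gtn_eqF ?prime_gt0.
  by rewrite !cubcharE // exprAC.
have -> : r%:R * x = (r * (x : nat))%:R by rewrite natrM natr_Zp.
by rewrite addchar_natr // /addchar -exprM mulnC.
Qed.

(** Compare [gauss_frobenius] with [gauss_cube] for [w] and for [w ^+ 2]. Here
    [r.+1 %/ 3] is [(r - 1) / 3] or [(r + 1) / 3], whichever is an integer, and
    the factor [r] in the last exponent only records the sign [r] modulo 3. *)
Lemma jacobi_reciprocity (K : fieldType) (w z : K) (r : nat) :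
  3.-primitive_root w -> q.-primitive_root z -> r \in [pchar K] -> r != 3%N ->
  r%:R != 0 :> 'F_q ->
  jacobi m g w ^+ (r.+1 %/ 3) =
  jacobi m g (w ^+ 2) ^+ (r.+1 %/ 3) * w ^+ (r * cubind m g r%:R).
Proof.
move=> w3 zq r_char r3 r0; have r_pr := pcharf_prime r_char.
have w23 := omega_sqr_prim w3.
have qK0 := prim_root_natf_neq0 zq.
have [G0 G'0] := (gauss_neq0 w3 zq, gauss_neq0 w23 zq).
have [G3 G'3] := (gauss_cube w3 zq, gauss_cube w23 zq).
have GG' := gauss_mul_conj q_pr q_eq g3 zq w3.
have := gauss_frobenius w3 zq r_char r3 r0.
have := gauss_frobenius w23 zq r_char r3 r0.
set k := cubind m g _.
set G := gauss m g z w in G0 G3 GG' *.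
set G' := gauss m g z (w ^+ 2) in G'0 G'3 GG' *.
set J := jacobi m g w in G3 *; set J' := jacobi m g (w ^+ 2) in G'3 *.
have [e [-> [r_eq|r_eq]]] := prime_mod3 r_pr r3.
- have wr := omega_expr_1mod3 w3 r_eq.
  have Gr : G ^+ r = G * (q%:R * J) ^+ e by rewrite r_eq exprS exprM G3.
  have G'r : G' ^+ r = G' * (q%:R * J') ^+ e by rewrite r_eq exprS exprM G'3.
  rewrite (exprAC w 2 r) exprM !wr (exprAC w 2 k) [(w ^+ k) ^+ 2]expr2 Gr G'r.
  rewrite -/G -/G'.
  clearbody G G' J J' k => eq2 eq1.
  apply: (mulIf (expf_neq0 e qK0)).
  have eq1' : w ^+ k * (q%:R * J) ^+ e = 1.
    by apply: (mulIf G0); rewrite mul1r -[RHS]eq1; ring.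
  have eq2' : w ^+ k * w ^+ k * (q%:R * J') ^+ e = 1.
    by apply: (mulIf G'0); rewrite mul1r -[RHS]eq2; ring.
  apply: (mulfI (expf_neq0 k (omega_neq0 w3))).
  by rewrite -exprMn [J * _]mulrC eq1' -[LHS]eq2' exprMn; ring.
have wr := omega_expr_2mod3 w3 r_eq.
rewrite (exprAC w 2 r) exprM !wr omega_sqr_sqr // (exprAC w 2 k) [(w ^+ k) ^+ 2]expr2.
rewrite -/G -/G'; clearbody G G' J J' k.
move=> eq2 eq1; apply: (mulIf (expf_neq0 e qK0)).
have eq1' : w ^+ k * w ^+ k * (q%:R * J) ^+ e = q%:R.
  by rewrite -G3 -exprM -r_eq exprS -GG' -eq1; ring.
have eq2' : w ^+ k * (q%:R * J') ^+ e = q%:R.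
  by rewrite -G'3 -exprM -r_eq exprS -GG' -[in RHS]eq2; ring.
have wk3 : w ^+ k ^+ 3 = 1 by rewrite exprAC (prim_expr_order w3) expr1n.
rewrite -exprMn [J * _]mulrC; transitivity (w ^+ k * q%:R).
  by rewrite -[in RHS]eq1' -[LHS]mul1r -[X in X * _ = _]wk3; ring.
by rewrite -[in LHS]eq2' exprMn; ring.
Qed.

End PrimeReciprocity.

(** * Reduction of binary quadratic forms *)

(** Gauss reduction: translate to bring [b] between [-a] and [a], then exchange
    the outer coefficients if [c < a], which lowers the leading coefficient. *)
Lemma form_reduction (a b c : int) : 0 < a -> 0 < 4 * a * c - b ^+ 2 ->
  exists a' b' c' : int, [/\ 0 < a', 4 * a' * c' - b' ^+ 2 = 4 * a * c - b ^+ 2,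
    - a' <= b' <= a', a' <= c'
  & forall x y : int, exists x' y' : int,
    a * x ^+ 2 + b * x * y + c * y ^+ 2 =
    a' * x' ^+ 2 + b' * x' * y' + c' * y' ^+ 2].
Proof.
have [n] := ubnP `|a|%N; elim: n a b c => // n IHn a b c a_lt a_gt0 D_gt0.
have [k [b1 [b_eq b1_bound]]] : exists k b1 : int,
    b = b1 + 2 * a * k /\ - a <= b1 <= a.
  exists ((b + a) %/ (2 * a))%Z, (((b + a) %% (2 * a))%Z - a).
  have := divz_eq (b + a) (2 * a).
  have : 0 <= ((b + a) %% (2 * a))%Z by apply: modz_ge0; lia.
  have : ((b + a) %% (2 * a))%Z < 2 * a by apply: ltz_pmod; lia.
  by set u := (_ %/ _)%Z; set v := (_ %% _)%Z; rewrite [u * _]mulrC; lia.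
pose c1 := c - b1 * k - a * k ^+ 2.
have D_eq : 4 * a * c1 - b1 ^+ 2 = 4 * a * c - b ^+ 2.
  by rewrite /c1 b_eq; ring.
have val1 (x y : int) : a * x ^+ 2 + b * x * y + c * y ^+ 2 =
    a * (x + k * y) ^+ 2 + b1 * (x + k * y) * y + c1 * y ^+ 2.
  by rewrite /c1 b_eq; ring.
have [a_le|c1_lt] := lerP a c1.
  by exists a, b1, c1; split=> // x y; exists (x + k * y), y.
have c1_gt0 : 0 < c1.
  have : 0 < 4 * a * c1 by have := sqr_ge0 b1; move: D_eq D_gt0; lia.
  by rewrite pmulr_rgt0 //; lia.
have [||a' [b' [c' [a'0 D' b'a' a'c' val']]]] := IHn c1 b1 a _ c1_gt0.
- by lia.
- by rewrite [4 * c1 * a]mulrAC D_eq.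
exists a', b', c'; split=> // [|x y]; first by rewrite D' -D_eq; ring.
have [x' [y' xy']] := val' y (x + k * y).
by exists x', y'; rewrite val1 -xy'; ring.
Qed.

(** A reduced form satisfies [3 * a ^+ 2 <= 4 * a * c - b ^+ 2]; this covers
    the discriminants -3 and -11. *)
Lemma reduced_leading1 (a b c : int) : 0 < a -> - a <= b <= a -> a <= c ->
  4 * a * c - b ^+ 2 < 12 -> a = 1.
Proof.
move=> a0 /andP[b1 b2] ac D12; apply: contraTeq D12 => a1; rewrite -leNgt.
have : 0 <= (a - b) * (a + b) by apply: mulr_ge0; lia.
have : 0 <= a * (c - a) by apply: mulr_ge0; lia.
have : 0 <= (a - 2) * (a + 2) by apply: mulr_ge0; lia.
by lia.
Qed.

(** The form [(q, 2 h + 1, (h^2 + h + 1) / q)] has discriminant -3 and takes the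
    value [q] at [(1, 0)]; the reduced forms are [x^2 +- x y + y^2]. *)
Lemma norm_form3 (q h : int) : 0 < q -> (q %| h ^+ 2 + h + 1)%Z ->
  exists x y : int, q = x ^+ 2 - x * y + y ^+ 2.
Proof.
move=> q0 /dvdzP[c hc].
have D3 : 4 * q * c - (2 * h + 1) ^+ 2 = 3.
  by rewrite -mulrA [q * c]mulrC -hc; ring.
have [|a' [b' [c' [a0 D' ba ac val]]]] := @form_reduction q (2 * h + 1) c q0.
  by rewrite D3.
have a1 : a' = 1 by apply: (reduced_leading1 a0 ba ac); rewrite D' D3.
have [x [y]] := val 1 0; rewrite a1 in D' ba *.
have -> : q * 1 ^+ 2 + (2 * h + 1) * 1 * 0 + c * 0 ^+ 2 = q by ring.
have [b1|[b1|b1]] : b' = 0 \/ b' = 1 \/ b' = -1 by lia.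
- by move: D'; rewrite D3 b1 expr0n /=; lia.
- have -> : c' = 1 by move: D'; rewrite D3 b1 expr1n; lia.
  by rewrite b1 => ->; exists x, (- y); ring.
- have -> : c' = 1 by move: D'; rewrite D3 b1 sqrrN expr1n; lia.
  by rewrite b1 => ->; exists x, y; ring.
Qed.

(** The reduced forms of discriminant -11 are [x^2 +- x y + 3 y^2], whose fourfold
    is [(2 x +- y)^2 + 11 y^2]. *)
Lemma norm_form11 (p h : int) : 0 < p -> (4 * p %| h ^+ 2 + 11)%Z ->
  exists x y : int, 4 * p = x ^+ 2 + 11 * y ^+ 2.
Proof.
move=> p0 /dvdzP[c hc].
have D11 : 4 * p * c - h ^+ 2 = 11 by rewrite [4 * p * c]mulrC -hc; ring.
have [|a' [b' [c' [a0 D' ba ac val]]]] := @form_reduction p h c p0.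
  by rewrite D11.
have a1 : a' = 1 by apply: (reduced_leading1 a0 ba ac); rewrite D' D11.
have [x [y]] := val 1 0; rewrite a1 in D' ba *.
have -> : p * 1 ^+ 2 + h * 1 * 0 + c * 0 ^+ 2 = p by ring.
move=> p_eq; exists (2 * x + b' * y), y; rewrite D11 in D'.
by rewrite -[11]D' p_eq; ring.
Qed.

(** One of [x], [y], [x - y] is divisible by 3, since otherwise [x + y], whose
    square is congruent to the norm, would be; the three cases are exchanged by
    multiplication by [omega]. *)
Lemma primary_associate (q x y : int) : ~~ (3 %| q)%Z ->
  q = x ^+ 2 - x * y + y ^+ 2 ->
  exists c d : int, (3 %| d)%Z /\ c ^+ 2 - c * d + d ^+ 2 = q.
Proof.
move=> q3 q_eq.
have [y3|y3] := boolP (3 %| y)%Z; first by exists x, y.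
have [x3|x3] := boolP (3 %| x)%Z.
  by exists (y - x), (- x); split; [lia | rewrite q_eq; ring].
have [xy3|xy3] := boolP (3 %| x - y)%Z.
  by exists (- y), (x - y); split; [lia | rewrite q_eq; ring].
have /dvdzP[t t_eq] : (3 %| x + y)%Z by lia.
case/negP: q3; apply/dvdzP; exists (3 * t ^+ 2 - x * y).
by rewrite q_eq (_ : x = t * 3 - y); [ring | rewrite -t_eq; ring].
Qed.

(** * Cubic reciprocity between Eisenstein integers and rational primes *)

Definition eis_norm (a b : int) : nat := absz (a ^+ 2 - a * b + b ^+ 2)%R.

Lemma eis_normE (a b : int) : (eis_norm a b)%:Z = a ^+ 2 - a * b + b ^+ 2.
Proof.
rewrite /eis_norm gez0_abs //.
rewrite -(pmulr_rge0 _ (isT : 0 < 4 :> int)).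
have -> : 4 * (a ^+ 2 - a * b + b ^+ 2) = (2 * a - b) ^+ 2 + 3 * b ^+ 2 by ring.
by apply: addr_ge0; [exact: sqr_ge0 | apply: mulr_ge0; [| exact: sqr_ge0]].
Qed.

Lemma eis_normM (a b c d : int) :
  eis_norm (a * c - b * d) (a * d + b * c - b * d) =
  (eis_norm a b * eis_norm c d)%N.
Proof.
by apply/eqP; rewrite -eqz_nat PoszM !eis_normE; apply/eqP; ring.
Qed.

(** [psi n], read modulo 3, is the logarithm in base [omega] of the cubic
    residue symbol of the integer [n] modulo [a + b * omega]. The second field
    contains both its periodicity and its triviality at -1. The last one is
    reciprocity: the symbol of [r] modulo [a + b * omega] is read off in
    characteristic [r]. *)
Record cubic_symbol (a b : int) (psi : nat -> nat) : Prop := CubicSymbol {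
  symbolM : forall m n, coprime m (eis_norm a b) -> coprime n (eis_norm a b) ->
    psi (m * n)%N = psi m + psi n %[mod 3];
  symbol_opp : forall m n, (eis_norm a b %| m + n)%N ->
    coprime m (eis_norm a b) -> psi m = psi n %[mod 3];
  symbol_reciprocity : forall r, r != 3%N -> coprime r (eis_norm a b) ->
    forall (K : closedFieldType) (w : K), r \in [pchar K] ->
    3.-primitive_root w ->
    eis w a b ^+ (r.+1 %/ 3) =
    eis (w ^+ 2) a b ^+ (r.+1 %/ 3) * w ^+ (r * psi r) }.

Lemma cubic_symbol_rational (a : int) : cubic_symbol a 0 (fun=> 0%N).
Proof. by split=> // r _ _ K w _ _; rewrite /eis !mul0r muln0 expr0 mulr1. Qed.

(** A rational factor is invisible on both sides of reciprocity. *)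
Lemma cubic_symbol_scale (k a b : int) (psi : nat -> nat) :
  cubic_symbol a b psi -> cubic_symbol (k * a) (k * b) psi.
Proof.
case=> psiM psiN psiR.
have N_eq : eis_norm (k * a) (k * b) = (eis_norm k 0 * eis_norm a b)%N.
  by rewrite -eis_normM; congr eis_norm; ring.
have cop m : coprime m (eis_norm (k * a) (k * b)) -> coprime m (eis_norm a b).
  by rewrite N_eq coprimeMr => /andP[].
split=> [m n /cop m_cop /cop n_cop|m n mn /cop m_cop|r r3 /cop r_cop K w r_char w3].
- exact: psiM.
- by apply: psiN => //; apply: dvdn_trans mn; rewrite N_eq dvdn_mull.
have scale (v : K) : eis v (k * a) (k * b) = k%:~R * eis v a b.
  by rewrite /eis !rmorphM /=; ring.
by rewrite !scale !exprMn -mulrA; congr (_ * _); apply: psiR.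
Qed.

(** The residue field at a prime of degree one: [omega] is congruent to
    [- a / b]. *)
Lemma prime_norm_root (q : nat) (a b : int) : prime q -> q != 3%N ->
  (q %| eis_norm a b)%N -> ~~ (q %| b)%Z ->
  exists g : 'F_q, 3.-primitive_root g /\ eis g a b = 0.
Proof.
move=> q_pr q3 qN qb.
have b0 : b%:~R != 0 :> 'F_q by rewrite -(dvdz_pcharf (Fq_char q_pr)).
exists (- a%:~R / b%:~R); split; last first.
  by rewrite /eis mulrC divfK ?subrr.
apply: omega_prim.
  by rewrite -(dvdn_pcharf (Fq_char q_pr)) dvdn_prime2.
have : (a ^+ 2 - a * b + b ^+ 2)%:~R = 0 :> 'F_q.
  by rewrite -eis_normE; apply/eqP; rewrite -pmulrn -(dvdn_pcharf (Fq_char q_pr)).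
rewrite !rmorphD rmorphN !rmorphXn rmorphM /=.
set x := a%:~R; set y : 'F_q := b%:~R in b0 * => xy.
apply: (mulfI (expf_neq0 2 b0)); rewrite mulr0 -[RHS]xy.
by field.
Qed.

Lemma omega_root_prime (q : nat) (g : 'F_q) : prime q ->
  3.-primitive_root g -> exists m, q = (3 * m).+1.
Proof.
move=> q_pr g3; exists (q.-1 %/ 3)%N.
have : (3 %| q.-1)%N.
  rewrite (prim_order_dvd g3); apply/eqP; apply: (mulfI (omega_neq0 g3)).
  rewrite mulr1 -exprS prednK ?prime_gt0 //.
  by have := expf_card g; rewrite card_Fp.
by have := prime_gt0 q_pr; lia.
Qed.

(** An Eisenstein integer of norm [q], or else its conjugate, vanishes at the
    same root [g] as [a + b * omega] and hence divides it. *)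
Lemma primary_factor (q : nat) (a b : int) (g : 'F_q) : prime q -> q != 3%N ->
  (3 %| b)%Z -> 3.-primitive_root g -> eis g a b = 0 -> ~~ (q %| b)%Z ->
  exists c d a' b' : int, [/\ eis g c d = 0, c ^+ 2 - c * d + d ^+ 2 = q%:Z,
    (3 %| d)%Z /\ (3 %| b')%Z
  & a = c * a' - d * b' /\ b = c * b' + d * a' - d * b'].
Proof.
move=> q_pr q3 b3 g3 g_ab qb.
have q_char := Fq_char q_pr.
have q_gt0 : 0 < q%:Z by rewrite ltz_nat prime_gt0.
have q3' : ~~ (3 %| q%:Z)%Z by rewrite dvdzE /= dvdn_prime2 // eq_sym.
have g0 := omega_eq0 g3.
have [h hg] : exists h : int, h%:~R = g by exists (val g)%:Z; rewrite -pmulrn natr_Zp.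
have [x [y /(primary_associate q3')[c0 [d0 [d3 N0]]]]] : exists x y : int,
    q%:Z = x ^+ 2 - x * y + y ^+ 2.
  apply: (@norm_form3 _ h q_gt0); rewrite (dvdz_pcharf q_char).
  by rewrite !rmorphD rmorphXn /= hg -g0; apply/eqP; ring.
have [c [d [d3' N g_cd]]] : exists c d : int, [/\ (3 %| d)%Z,
    c ^+ 2 - c * d + d ^+ 2 = q%:Z & eis g c d = 0].
  have : eis g c0 d0 * eis (g ^+ 2) c0 d0 = 0.
    by rewrite eis_conj_mul // N0 -pmulrn (pcharf0 q_char).
  move/eqP; rewrite mulf_eq0 => /orP[] /eqP g_cd; first by exists c0, d0.
  exists (c0 - d0), (- d0); split; [by rewrite rpredN | by rewrite -N0; ring |].
  rewrite -g_cd /eis rmorphB rmorphN /=; apply/eqP; rewrite -subr_eq0; apply/eqP.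
  transitivity (- d0%:~R * (1 + g + g ^+ 2)); first by ring.
  by rewrite g0 mulr0.
move/eqP: (g_ab); rewrite /eis addr_eq0 => /eqP aE.
move/eqP: (g_cd); rewrite /eis addr_eq0 => /eqP cE.
have /dvdzP[b' b'E] : (q %| b * c - a * d)%Z.
  rewrite (dvdz_pcharf q_char) rmorphB !rmorphM /= aE cE.
  by apply/eqP; ring.
have /dvdzP[a' a'E] : (q %| a * c - a * d + b * d)%Z.
  rewrite (dvdz_pcharf q_char) rmorphD rmorphB !rmorphM /= aE cE.
  apply/eqP; transitivity (b%:~R * d%:~R * (1 + g + g ^+ 2)); first by ring.
  by rewrite g0 mulr0.
have q0 : q%:Z != 0 by rewrite lt0r_neq0.
have aE' : a = c * a' - d * b'.
  apply: (mulIf q0); rewrite mulrBl -!mulrA -a'E -b'E -N; ring.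
have bE' : b = c * b' + d * a' - d * b'.
  apply: (mulIf q0); rewrite mulrBl mulrDl -!mulrA -a'E -b'E -N; ring.
exists c, d, a', b'; split=> //; split=> //.
have : (3 %| q%:Z * b')%Z.
  by rewrite mulrC -b'E rpredB //; [apply: dvdz_mulr | apply: dvdz_mull].
by rewrite Gauss_dvdzr // coprimezE /= prime_coprime // dvdn_prime2 // eq_sym.
Qed.

Lemma cubic_symbol_prime_mul (q m : nat) (g : 'F_q) (a b c d : int)
    (psi : nat -> nat) :
  prime q -> q = (3 * m).+1 -> 3.-primitive_root g ->
  eis g c d = 0 -> c ^+ 2 - c * d + d ^+ 2 = q%:Z -> (3 %| d)%Z ->
  cubic_symbol a b psi ->
  cubic_symbol (c * a - d * b) (c * b + d * a - d * b)
    (fun n => cubind m g n%:R + psi n)%N.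
Proof.
move=> q_pr q_eq g3 g_cd N d3 [psiM psiN psiR].
have q_char := Fq_char q_pr.
have N_eq : eis_norm (c * a - d * b) (c * b + d * a - d * b) =
    (q * eis_norm a b)%N.
  by rewrite eis_normM; congr (_ * _)%N; rewrite /eis_norm N.
have cop n : coprime n (q * eis_norm a b) ->
    n%:R != 0 :> 'F_q /\ coprime n (eis_norm a b).
  rewrite coprimeMr => /andP[nq ->]; split=> //.
  by rewrite -(dvdn_pcharf q_char) -prime_coprime // coprime_sym.
split=> [n1 n2|n1 n2|r r3]; rewrite N_eq.
- move=> /cop[n10 n1_cop] /cop[n20 n2_cop].
  rewrite natrM -modnDm (cubindM q_pr q_eq g3) // psiM //.
  by rewrite modnDm addnACA.
- move=> n_dvd /cop[n10 n1_cop]; rewrite -modnDm.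
  rewrite (psiN n1 n2) //; last by apply: dvdn_trans n_dvd; apply: dvdn_mull.
  have -> : n1%:R = - n2%:R :> 'F_q.
    apply/eqP; rewrite -addr_eq0 -natrD -(dvdn_pcharf q_char).
    by apply: dvdn_trans n_dvd; apply: dvdn_mulr.
  rewrite (cubindN q_pr q_eq g3) ?modnDm //.
  have := n10; apply: contraNneq => n20; have : (n1 + n2)%:R = 0 :> 'F_q.
    by apply/eqP; rewrite -(dvdn_pcharf q_char); apply: dvdn_trans n_dvd; apply: dvdn_mulr.
  by rewrite natrD n20 addr0 => ->.
move=> /cop[r0 r_cop] K w r_char w3.
have [z zq] : exists z : K, q.-primitive_root z.
  apply: closed_exists_prim_root => //.
  rewrite -(dvdn_pcharf r_char) dvdn_prime2 ?(pcharf_prime r_char) //.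
  by apply: contraNneq r0 => ->; rewrite (pcharf0 q_char).
have [s jE] := jacobi_prime q_pr q_eq g3 N d3 g_cd.
have s0 : (-1) ^+ s != 0 :> K by rewrite signr_eq0.
have := jacobi_reciprocity q_pr q_eq g3 w3 zq r_char r3 r0.
rewrite !jE ?omega_sqr_prim // !exprMn -mulrA.
move/(mulfI (expf_neq0 _ s0)) => eq_cd.
rewrite !eisM ?omega_sqr_prim // !exprMn eq_cd (psiR r) // mulnDr exprD.
by rewrite mulrACA.
Qed.

(** Induction on the norm: a prime [q] dividing the norm either divides both
    coordinates or provides a factor of norm [q]. *)
Theorem cubic_symbol_exists (a b : int) : (3 %| b)%Z -> ~~ (3 %| a)%Z ->
  exists psi, cubic_symbol a b psi.
Proof.
have [n] := ubnP (eis_norm a b); elim: n a b => // n IHn a b N_lt b3 a3.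
have [->|b0] := eqVneq b 0; first by eexists; apply: cubic_symbol_rational.
have N3 : ~~ (3 %| eis_norm a b)%N.
  apply: contra a3 => N3; have : (3 %| (eis_norm a b)%:Z)%Z by [].
  rewrite eis_normE => /dvdzP[t N_eq]; move/dvdzP: b3 => [u b_eq].
  have : (3 %| a ^+ 2)%Z.
    apply/dvdzP; exists (t + a * u - 3 * u ^+ 2).
    by rewrite [RHS]mulrBl mulrDl -N_eq b_eq; ring.
  by rewrite !dvdzE abszX Euclid_dvdX // => /andP[].
have N_gt1 : (1 < eis_norm a b)%N.
  have /dvdzP[u b_eq] := b3; have u0 : u != 0.
    by apply: contra_neq b0 => u0; rewrite b_eq u0 mul0r.
  have : 0 < u ^+ 2 by rewrite exprn_even_gt0.
  have : 4 * (eis_norm a b)%:Z = (2 * a - b) ^+ 2 + 27 * u ^+ 2.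
    by rewrite eis_normE b_eq; ring.
  by have := sqr_ge0 (2 * a - b); lia.
pose q := pdiv (eis_norm a b); have q_pr : prime q := pdiv_prime N_gt1.
have qN : (q %| eis_norm a b)%N := pdiv_dvd _.
have q1 := prime_gt1 q_pr.
have q3 : q != 3%N by apply: contraTneq qN => ->.
have norm_lt k M : (1 < k)%N -> eis_norm a b = (k * M)%N -> (M < n)%N.
  move=> k1 NM; move: N_lt N_gt1; rewrite NM ltnS => kM_le kM_gt1.
  apply: leq_trans kM_le; apply: ltn_Pmull => //.
  by case: M kM_gt1 {NM} => //; rewrite muln0.
have [/dvdzP[b' b_eq]|qb] := boolP (q %| b)%Z.
  have /dvdzP[a' a_eq] : (q %| a)%Z.
    have : (q %| a ^+ 2)%Z.
      have : (q %| (eis_norm a b)%:Z)%Z by [].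
      rewrite eis_normE => /dvdzP[t N_eq]; apply/dvdzP.
      exists (t + a * b' - q%:Z * b' ^+ 2).
      by rewrite [RHS]mulrBl mulrDl -N_eq b_eq; ring.
    by rewrite !dvdzE abszX Euclid_dvdX // => /andP[].
  rewrite mulrC in a_eq; rewrite mulrC in b_eq.
  have N_eq : eis_norm a b = (q ^ 2 * eis_norm a' b')%N.
    apply/eqP; rewrite -eqz_nat PoszM -mulnn PoszM !eis_normE a_eq b_eq.
    by apply/eqP; ring.
  have [|||psi psi_ab] := IHn a' b'.
  - by apply: norm_lt N_eq; rewrite -mulnn; apply: (leq_trans q1); rewrite leq_pmulr // ltnW.
  - have cop : coprimez 3 q%:Z.
      by rewrite coprimezE /= prime_coprime // dvdn_prime2 // eq_sym.
    by rewrite -(Gauss_dvdzr _ cop) -b_eq.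
  - by apply: contra a3; rewrite a_eq; apply: dvdz_mull.
  by exists psi; rewrite a_eq b_eq; apply: cubic_symbol_scale.
have [g [g3 g_ab]] := prime_norm_root q_pr q3 qN qb.
have [m q_eq] := omega_root_prime q_pr g3.
have [c [d [a' [b' [g_cd N_cd [d3 b'3] [a_eq b_eq]]]]]] :=
  primary_factor q_pr q3 b3 g3 g_ab qb.
have N_eq : eis_norm a b = (q * eis_norm a' b')%N.
  by rewrite a_eq b_eq eis_normM; congr (_ * _)%N; rewrite /eis_norm N_cd.
have [|||psi psi_ab] := IHn a' b'.
- exact: norm_lt q1 N_eq.
- exact: b'3.
- apply: contra a3 => a'3; rewrite a_eq rpredB //.
    exact: dvdz_mull.
  exact: dvdz_mulr.
exists (fun n => cubind m g n%:R + psi n)%N; rewrite a_eq b_eq.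
exact: cubic_symbol_prime_mul.
Qed.

(** * The symbol attached to a representation by the form of discriminant -11 *)

Lemma algebraic_closure_Fp (p : nat) : prime p ->
  exists K : closedFieldType, p \in [pchar K].
Proof.
move=> p_pr; have [K [f _]] := countable_algebraic_closure 'F_p.
by exists K; rewrite (fmorph_pchar f) pchar_Fp.
Qed.

Section SymbolValues.

Variables (a b : int) (psi : nat -> nat).
Hypothesis psiP : cubic_symbol a b psi.

Let N := eis_norm a b.

Lemma symbol1 : (3 %| psi 1)%N.
Proof. by have := symbolM psiP (coprime1n _) (coprime1n _); rewrite muln1; lia. Qed.

Lemma symbolX m k : coprime m N -> psi (m ^ k)%N = k * psi m %[mod 3].
Proof.
move=> m_cop; elim: k => [|k IHk]; first by rewrite expn0; have := symbol1; lia.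
by rewrite expnS (symbolM psiP) ?coprimeXl // mulSn -modnDmr IHk modnDmr.
Qed.

(** The divisibility says that [a + b * omega] is congruent to its conjugate or
    to the opposite of its conjugate modulo [r]: the difference of the squares of
    the two is [b * (2 * a - b) * (omega - omega ^ 2)]. *)
Lemma symbol_prime_eq0 (r : nat) : prime r -> r != 3%N -> coprime r N ->
  (r %| b * (2 * a - b))%Z -> (3 %| psi r)%N.
Proof.
move=> r_pr r3 r_cop r_dvd; have [K r_char] := algebraic_closure_Fp r_pr.
have [w w3] : exists w : K, 3.-primitive_root w.
  by apply: closed_exists_prim_root => //; rewrite -(dvdn_pcharf r_char) dvdn_prime2.
have N0 : eis w a b * eis (w ^+ 2) a b != 0.
  rewrite eis_conj_mul // -eis_normE -pmulrn -(dvdn_pcharf r_char).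
  by rewrite -prime_coprime.
have sqr_eq : eis w a b ^+ 2 = eis (w ^+ 2) a b ^+ 2.
  apply/eqP; rewrite -subr_eq0; apply/eqP.
  transitivity ((b * (2 * a - b))%:~R * (w - w ^+ 2) +
      b%:~R ^+ 2 * (w - w ^+ 2) * (1 + w + w ^+ 2)).
    by rewrite /eis rmorphM rmorphB rmorphM /=; ring.
  rewrite omega_eq0 // mulr0 addr0.
  by move: r_dvd; rewrite (dvdz_pcharf r_char) => /eqP->; rewrite mul0r.
have [_ w0'] : eis w a b != 0 /\ eis (w ^+ 2) a b != 0.
  by move: N0; rewrite mulf_eq0 negb_or => /andP[].
have e_eq := symbol_reciprocity psiP r3 r_cop r_char w3.
have /eqP : w ^+ (r * psi r * 2) = 1.
  apply: (mulfI (expf_neq0 (r.+1 %/ 3) (expf_neq0 2 w0'))).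
  by rewrite mulr1 -[in RHS]sqr_eq -!(exprAC _ _ 2) e_eq exprMn exprM.
rewrite -(prim_order_dvd w3) !Euclid_dvdM // dvdn_prime2 // eq_sym (negPf r3).
by rewrite /= orbF.
Qed.

Lemma symbol_eq0 (n : nat) : (0 < n)%N -> coprime n N ->
  (forall r, prime r -> (r %| n)%N -> r != 3%N /\ (r %| b * (2 * a - b))%Z) ->
  (3 %| psi n)%N.
Proof.
have [k] := ubnP n; elim: k n => // k IHk n n_lt n0 n_cop n_dvd.
have [n1|n1] := leqP n 1; first by rewrite (_ : n = 1%N) ?symbol1 //; lia.
pose r := pdiv n; have r_pr : prime r := pdiv_prime n1.
have /dvdnP[n' n_eq] : (r %| n)%N := pdiv_dvd n.
have r1 := prime_gt1 r_pr.
move: (n_cop); rewrite n_eq coprimeMl => /andP[n'_cop r_cop].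
have n'0 : (0 < n')%N by rewrite lt0n; apply: contraTneq n0 => n'0; rewrite n_eq n'0 mul0n.
have n'_lt : (n' < n)%N by rewrite n_eq ltn_Pmulr.
have psi_n' : (3 %| psi n')%N.
  apply: IHk => // [|t t_pr t_dvd]; first exact: leq_trans n'_lt _.
  by apply: n_dvd => //; rewrite n_eq dvdn_mulr.
have psi_r : (3 %| psi r)%N.
  have [r3 r_dvd] := n_dvd r r_pr (pdiv_dvd n).
  exact: symbol_prime_eq0.
by have := symbolM psiP n'_cop r_cop; rewrite -n_eq; move: psi_n' psi_r; clear; lia.
Qed.

(** For [r = 2] the exponent in reciprocity is 1, so a trivial symbol means that
    [a + b * omega] equals its conjugate modulo 2. *)
Lemma symbol2 : coprime 2 N -> (3 %| psi 2)%N -> (2 %| b)%Z.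
Proof.
move=> N2 psi2; have [K K2] := algebraic_closure_Fp (isT : prime 2).
have [w w3] : exists w : K, 3.-primitive_root w.
  by apply: closed_exists_prim_root => //; rewrite -(dvdn_pcharf K2).
have := symbol_reciprocity psiP (isT : 2%N != 3) N2 K2 w3; rewrite !expr1.
have /eqP-> : w ^+ (2 * psi 2) == 1 by rewrite -(prim_order_dvd w3) dvdn_mull.
rewrite mulr1 => /eqP; rewrite -subr_eq0.
have -> : eis w a b - eis (w ^+ 2) a b = b%:~R * (w * (1 - w)) by rewrite /eis; ring.
have w1 : 1 - w != 0.
  by rewrite subr_eq0 eq_sym -(prim_order_dvd w3 1 : _ = (w == 1)).
by rewrite !mulf_eq0 (negPf w1) (negPf (omega_neq0 w3)) !orbF (dvdz_pcharf K2).
Qed.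

End SymbolValues.

Lemma dvdz2_sub (m n : int) : (2 %| (m - n) * (m + n))%Z -> (2 %| m - n)%Z.
Proof. by rewrite !dvdzE abszM Euclid_dvdM // => /orP[]; lia. Qed.

(** Apply reciprocity to [A = (19 n + 3 m sqrt(-3)) / 2], whose norm is
    [27 P + 16 n^2]; see the beginning of the file. The multiple [P = 11 p] is
    harmless because [A] is rational modulo 11 when 11 divides [m]. *)
Lemma scaled_norm_form_symbol (p P : nat) (m n : int) :
  prime p -> p != 2%N -> p != 3%N ->
  odd P -> coprime `|n|%N P ->
  P = p \/ P = (11 * p)%N /\ (11 %| m)%Z ->
  4 * P%:Z = m ^+ 2 + 11 * n ^+ 2 -> (3 %| m)%Z -> ~~ (3 %| n)%Z ->
  exists psi : nat, ((3 %| psi)%N <-> (2 %| n)%Z) /\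
    forall (K : closedFieldType) (w : K), p \in [pchar K] ->
    3.-primitive_root w ->
    (19 * n%:~R + 3 * m%:~R * (1 + 2 * w)) ^+ (p.+1 %/ 3) =
    (19 * n%:~R - 3 * m%:~R * (1 + 2 * w)) ^+ (p.+1 %/ 3) * w ^+ (p * psi).
Proof.
move=> p_pr p2 p3 P_odd nP P_eq mn m3 n3.
have p_dvd_P : (p %| P)%N by case: P_eq => [->|[-> _]]; rewrite ?dvdn_mull.
have mn2 : (2 %| m - n)%Z.
  have : (2 %| (m - n) * (m + n))%Z.
    by apply/dvdzP; exists (2 * P%:Z - 6 * n ^+ 2); move: mn; clear; lia.
  exact: dvdz2_sub.
have [a a_eq] : exists a : int, 2 * a = 19 * n + 3 * m.
  by move/dvdzP: mn2 => [t t_eq]; exists (11 * n + 3 * t); move: t_eq; clear; lia.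
pose b := 3 * m; have ab_eq : 2 * a - b = 19 * n by rewrite a_eq /b; ring.
have N_eq : eis_norm a b = (27 * P + 16 * `|n| ^ 2)%N.
  apply/eqP; rewrite -eqz_nat PoszD !PoszM eis_normE.
  have -> : `|n|%N%:Z * `|n|%N%:Z = n ^+ 2.
    by rewrite !abszE -expr2 real_normK ?num_real.
  apply/eqP; apply: (mulfI (isT : 4 != 0 :> int)).
  transitivity ((2 * a - b) ^+ 2 + 3 * b ^+ 2); first by ring.
  by rewrite ab_eq mulrDr [4 * (27 * _)]mulrCA mn /b; ring.
have n0 : n != 0 by apply: contraNneq n3 => ->.
have n0' : (0 < `|n|)%N by rewrite absz_gt0.
have n3' : ~~ (3 %| `|n|)%N by [].
set N := eis_norm a b in N_eq *.
have N2 : coprime 2 N by rewrite prime_coprime // N_eq; move: P_odd; clear; lia.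
have N3 : coprime 3 N.
  rewrite prime_coprime // N_eq (_ : 27 * P = 3 * (9 * P))%N; last by clear; lia.
  rewrite (dvdn_addr _ (dvdn_mulr _ (dvdnn 3))).
  by rewrite Euclid_dvdM // Euclid_dvdX // andbT.
have nN : coprime `|n| N.
  rewrite N_eq addnC -mulnn mulnA /coprime gcdnMDl -/(coprime _ _).
  rewrite coprimeMr nP andbT.
  by rewrite coprime_sym (coprimeXl 3 (_ : coprime 3 _)) // prime_coprime.
have PN : coprime P N.
  rewrite N_eq /coprime gcdnMDl -/(coprime _ _) coprimeMr coprimeXr ?andbT.
    by rewrite (coprimeXr 4 (_ : coprime P 2)) // coprimen2.
  by rewrite coprime_sym.
have b3 : (3 %| b)%Z by apply: dvdz_mulr.
have a3 : ~~ (3 %| a)%Z by move: a_eq n3; clear; lia.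
have [psi psiP] := cubic_symbol_exists b3 a3.
have psi_n k : (k %| `|n|)%N -> (3 %| psi k)%N.
  move=> k_dvd; apply: (symbol_eq0 psiP); first exact: dvdn_gt0 k_dvd.
    exact: coprime_dvdl k_dvd nN.
  move=> r r_pr r_k; have r_n := dvdn_trans r_k k_dvd; split.
    by apply: contraTneq r_n => ->.
  by rewrite ab_eq dvdz_mull // dvdz_mull.
have psi_P : psi P = psi p %[mod 3].
  case: P_eq => [->//|[P_eq m11]].
  move: PN; rewrite P_eq coprimeMl => /andP[N11 Np].
  have : (3 %| psi 11)%N.
    by apply: (symbol_prime_eq0 psiP) => //; rewrite dvdz_mulr // dvdz_mull.
  by have := symbolM psiP N11 Np; clear; lia.
have N27 : coprime 27 N by rewrite (coprimeXl 3 N3).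
have N16 : coprime 16 N by rewrite (coprimeXl 4 N2).
(* Read off from [N = 27 * P + 16 * `|n| ^ 2]: the factor [27] is a cube. *)
have psi_eq : (psi p = 4 * psi 2 + 2 * psi `|n| %[mod 3])%N.
  have N_dvd : (N %| 27 * P + 16 * `|n| ^ 2)%N by rewrite -N_eq.
  have := symbol_opp psiP N_dvd; rewrite coprimeMl N27 PN => /(_ isT).
  rewrite (symbolM psiP) // (symbolM psiP) ?coprimeXl //.
  have := symbolX psiP 3 N3; have := symbolX psiP 4 N2; have := symbolX psiP 2 nN.
  rewrite -[(3 ^ 3)%N]/27%N -[(2 ^ 4)%N]/16%N.
  by move: psi_P; clear; lia.
exists (psi p); split.
  split=> [psi_p|n2].
    apply: contraTT psi_p => n2.
    have psi2 : ~~ (3 %| psi 2)%N.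
      apply: contra n2 => /(symbol2 psiP N2); rewrite /b; move: mn2; clear; lia.
    by have := psi_n _ (dvdnn _); move: psi_eq psi2; clear; lia.
  have /dvdnP[y n_eq] : (2 %| `|n|)%N by [].
  have psi_y : (3 %| psi y)%N by apply: psi_n; rewrite n_eq dvdn_mulr.
  move: nN; rewrite n_eq coprimeMl => /andP[yN _].
  have := symbolM psiP yN N2; rewrite -n_eq.
  by move: psi_eq psi_y; clear; lia.
move=> K w p_char w3.
have pN : coprime p N by apply: coprime_dvdl PN.
have two0 : 2%:R != 0 :> K by rewrite -(dvdn_pcharf p_char) dvdn_prime2.
have a2 : 2 * a%:~R = 19 * n%:~R + 3 * m%:~R :> K.
  by have := congr1 (fun x : int => x%:~R : K) a_eq; rewrite /= rmorphD !rmorphM.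
have -> : 19 * n%:~R + 3 * m%:~R * (1 + 2 * w) = 2 * eis w a b.
  by rewrite /eis [2 * (_ + _)]mulrDr a2 /b rmorphM /=; ring.
have -> : 19 * n%:~R - 3 * m%:~R * (1 + 2 * w) = 2 * eis (w ^+ 2) a b.
  rewrite /eis [2 * (_ + _)]mulrDr a2 /b rmorphM /=.
  apply/eqP; rewrite -subr_eq0; apply/eqP.
  transitivity (- (6 * m%:~R * (1 + w + w ^+ 2))); first by ring.
  by rewrite omega_eq0 // mulr0 oppr0.
rewrite !exprMn -mulrA; congr (_ * _).
exact: (symbol_reciprocity psiP).
Qed.

(** * Frobenius on the roots of the Tribonacci polynomial *)

Lemma not_dvd3_decomp (x : int) : ~~ (3 %| x)%Z ->
  exists u, exists s : int, s ^+ 2 = 1 /\ x = 3 * u + s.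
Proof.
move=> x3; have [/dvdzP[u u_eq]|/dvdzP[u u_eq]] :
    (3 %| x - 1)%Z \/ (3 %| x + 1)%Z by lia.
  by exists u, 1; split=> //; lia.
by exists u, (-1); split=> //; lia.
Qed.

(** Modulo 3 the equation reads [p = x^2 - y^2], so exactly one of [x], [y] is
    divisible by 3. If it is [x], take [(m, n) = (x, y)]; if it is [y], take
    [(m, n) = (- 11 y, x)], for which [m^2 + 11 n^2 = 44 p]. *)
Lemma norm_form_symbol (p : nat) (x y : int) : prime p -> p != 2%N -> p != 3%N ->
  p != 11%N -> 4 * p%:Z = x ^+ 2 + 11 * y ^+ 2 ->
  exists psi : nat, ((3 %| psi)%N <-> (2 %| y)%Z) /\
    forall (K : closedFieldType) (w : K), p \in [pchar K] ->
    3.-primitive_root w ->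
    exists s : K, [/\ s ^+ 2 = -11, s ^+ p = s
    & (19 + 3 * s * (1 + 2 * w)) ^+ (p.+1 %/ 3) =
      (19 - 3 * s * (1 + 2 * w)) ^+ (p.+1 %/ 3) * w ^+ (p * psi)].
Proof.
move=> p_pr p2 p3 p11 xy.
have p_odd : odd p by case: (even_prime p_pr) p2 => // ->.
suff [m [n [P [P_odd nP P_eq [mn m3 n3 n2]]]]] : exists m n P, [/\ odd P,
    coprime `|n|%N P, P = p \/ P = (11 * p)%N /\ (11 %| m)%Z
  & [/\ 4 * P%:Z = m ^+ 2 + 11 * n ^+ 2, (3 %| m)%Z, ~~ (3 %| n)%Z
    & (2 %| n)%Z = (2 %| y)%Z]].
  have [psi [psi_n psi_K]] :=
    scaled_norm_form_symbol p_pr p2 p3 P_odd nP P_eq mn m3 n3.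
  exists psi; split; first by rewrite -n2.
  move=> K w p_char w3; have p_dvd_P : (p %| P)%N.
    by case: P_eq => [->|[-> _]]; rewrite ?dvdn_mull.
  have n0 : n%:~R != 0 :> K.
    rewrite -(dvdz_pcharf p_char) dvdzE /= -prime_coprime // coprime_sym.
    exact: coprime_dvdr nP.
  have n_e0 : n%:~R ^+ (p.+1 %/ 3) != 0 :> K by rewrite expf_neq0.
  have Fr (u : int) : u%:~R ^+ p = u%:~R :> K.
    by rewrite -(pFrobenius_autE p_char) rmorph_int.
  exists (m%:~R / n%:~R); split.
  - apply: (mulIf (expf_neq0 2 n0)); rewrite -exprMn divfK //.
    apply/eqP; rewrite -subr_eq0.
    have : (m ^+ 2 + 11 * n ^+ 2)%:~R = 0 :> K.
      have /eqP P0 : P%:R == 0 :> K by rewrite -(dvdn_pcharf p_char).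
      by rewrite -mn rmorphM /= -[P%:Z%:~R]/(P%:R) P0 mulr0.
    rewrite rmorphD rmorphM !rmorphXn /= => mn0.
    by apply/eqP; rewrite -[RHS]mn0; ring.
  - by rewrite exprMn exprVn !Fr.
  have := psi_K K w p_char w3; set t := 1 + 2 * w => psi_t.
  apply: (mulIf n_e0); rewrite [RHS]mulrAC -!exprMn.
  have -> : (19 + 3 * (m%:~R / n%:~R) * t) * n%:~R = 19 * n%:~R + 3 * m%:~R * t.
    by field.
  have -> : (19 - 3 * (m%:~R / n%:~R) * t) * n%:~R = 19 * n%:~R - 3 * m%:~R * t.
    by field.
  exact: psi_t.
have p4 : ~~ (p %| 4)%N.
  by rewrite (Euclid_dvdX 2 2 p_pr) andbT dvdn_prime2.
have not_both u v : x = p%:Z * u -> y = p%:Z * v -> False.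
  move=> x_eq y_eq; case/negP: p4; have : (p %| 4%:Z)%Z => //.
  have p0 : p%:Z != 0 by rewrite eqz_nat -lt0n prime_gt0.
  apply/dvdzP; exists (u ^+ 2 + 11 * v ^+ 2); apply: (mulIf p0).
  by rewrite xy x_eq y_eq; ring.
have sqr_dvd t : (p %| t ^+ 2)%Z -> exists u, t = p%:Z * u.
  rewrite dvdzE abszX Euclid_dvdX // => /andP[t_dvd _].
  have /dvdzP[u ->] : (p %| t)%Z by [].
  by exists u; rewrite mulrC.
have p_11 (t : int) : (p %| 11 * t)%Z -> (p %| t)%Z.
  by rewrite Gauss_dvdzr // coprimezE /= prime_coprime // dvdn_prime2.
have py : coprime `|y|%N p.
  rewrite coprime_sym prime_coprime //; apply/negP=> y_dvd.
  have /dvdzP[v y_eq] : (p %| y)%Z by [].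
  have [|u x_eq] := sqr_dvd x; last by apply: (not_both u v) => //; rewrite mulrC.
  apply/dvdzP; exists (4 - 11 * y * v); rewrite mulrBl xy y_eq; ring.
have px : coprime `|x|%N p.
  rewrite coprime_sym prime_coprime //; apply/negP=> x_dvd.
  have /dvdzP[u x_eq] : (p %| x)%Z by [].
  have [|v y_eq] := sqr_dvd y; last by apply: (not_both u v) => //; rewrite mulrC.
  apply: p_11; apply/dvdzP; exists (4 - x * u); rewrite mulrBl xy x_eq; ring.
have p_3 : ~~ (3 %| 4 * p%:Z)%Z.
  have : ~~ (3 %| p)%N by rewrite dvdn_prime2 // eq_sym.
  by clear; lia.
have [x3|x3] := boolP (3 %| x)%Z.
  exists x, y, p; split=> //; first by left.
  split=> //; apply: contra p_3 => y3; rewrite xy.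
  by rewrite rpredD // ?dvdz_mull // exprS dvdz_mulr.
have y3 : (3 %| y)%Z.
  apply: contraNT p_3 => y3; rewrite xy.
  have [u [s [s2 x_eq]]] := not_dvd3_decomp x3.
  have [v [t [t2 y_eq]]] := not_dvd3_decomp y3.
  apply/dvdzP; exists (3 * u ^+ 2 + 2 * u * s + 33 * v ^+ 2 + 22 * v * t + 4).
  by rewrite x_eq y_eq !sqrrD s2 t2; ring.
exists (- 11 * y), x, (11 * p)%N; split=> //.
- by rewrite oddM.
- rewrite coprimeMr px andbT coprime_sym prime_coprime //; apply/negP => x_dvd.
  have /dvdzP[u x_eq] : (11 %| x)%Z by [].
  have : (11 %| 4 * p%:Z)%Z.
    by apply/dvdzP; exists (11 * u ^+ 2 + y ^+ 2); rewrite xy x_eq; ring.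
  by rewrite Gauss_dvdzr // dvdzE /= dvdn_prime2 // eq_sym (negPf p11).
- by right; split=> //; apply/dvdzP; exists (- y); ring.
split=> //; first by rewrite PoszM mulrCA xy; ring.
  by rewrite dvdz_mull.
have xy2 : (2 %| (x - y) * (x + y))%Z.
  apply/dvdzP; exists (2 * p%:Z - 6 * y ^+ 2).
  by transitivity (x ^+ 2 + 11 * y ^+ 2 - 12 * y ^+ 2); [ring | rewrite -xy; ring].
by move: (dvdz2_sub xy2); clear; lia.
Qed.

(** Cardano's formula for the Lagrange resolvent [x + w * y + w ^+ 2 * z]; its
    cube involves the square root [1 + 2 * w] of -3. *)
Lemma resolvent_cube (K : fieldType) (w x y z : K) : 3.-primitive_root w ->
  2 * (x + w * y - (1 + w) * z) ^+ 3 =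
  2 * (x + y + z) ^+ 3 - 9 * (x + y + z) * (x * y + y * z + z * x)
  + 27 * (x * y * z) - 3 * ((x - y) * (y - z) * (z - x)) * (1 + 2 * w).
Proof.
move=> w3; apply/eqP; rewrite -subr_eq0; apply/eqP.
transitivity ((1 + w + w ^+ 2) * (6 * (x - z) * (y - z) ^+ 2
   + 2 * (y - z) ^+ 3 * (w - 1))); first by ring.
by rewrite omega_eq0 // mul0r.
Qed.

Section Cubic.

Variables (K : fieldType) (p : nat) (al be ga : K).
Hypotheses (p_char : p \in [pchar K]).
Hypotheses (e1 : al + be + ga = 1) (e2 : al * be + be * ga + ga * al = -1)
  (e3 : al * be * ga = 1).

Lemma trib_root (x : K) : x ^+ 3 - x ^+ 2 - x - 1 = (x - al) * (x - be) * (x - ga).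
Proof.
have -> : x ^+ 3 - x ^+ 2 - x - 1 = x ^+ 3 - (al + be + ga) * x ^+ 2 +
  (al * be + be * ga + ga * al) * x - al * be * ga by rewrite e1 e2 e3; ring.
by ring.
Qed.

Definition vandermonde3 := (al - be) * (be - ga) * (ga - al).

(** The discriminant formula for a monic cubic polynomial. *)
Lemma trib_disc : vandermonde3 ^+ 2 = -44.
Proof.
transitivity ((al + be + ga) ^+ 2 * (al * be + be * ga + ga * al) ^+ 2
  - 4 * (al * be + be * ga + ga * al) ^+ 3
  - 4 * (al + be + ga) ^+ 3 * (al * be * ga)
  + 18 * (al + be + ga) * (al * be + be * ga + ga * al) * (al * be * ga)
  - 27 * (al * be * ga) ^+ 2); first by rewrite /vandermonde3; ring.
by rewrite e1 e2 e3; ring.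
Qed.

(** Both sides satisfy the Tribonacci recurrence and agree for [n < 3]; this is
    the Binet formula cleared of denominators. *)
Lemma tribonacci_roots (n : nat) : vandermonde3 * (tribonacci n)%:R =
  al ^+ n.+1 * (ga - be) + be ^+ n.+1 * (al - ga) + ga ^+ n.+1 * (be - al).
Proof.
have root3 (x : K) : (x - al) * (x - be) * (x - ga) = 0 -> x ^+ 3 = x ^+ 2 + x + 1.
  rewrite -trib_root => x0; apply/eqP; rewrite -subr_eq0; apply/eqP.
  by rewrite -[RHS]x0; ring.
have al3 : al ^+ 3 = al ^+ 2 + al + 1 by apply: root3; ring.
have be3 : be ^+ 3 = be ^+ 2 + be + 1 by apply: root3; ring.
have ga3 : ga ^+ 3 = ga ^+ 2 + ga + 1 by apply: root3; ring.
have step (x : K) : x ^+ 3 = x ^+ 2 + x + 1 ->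
    forall k, x ^+ k.+4 = x ^+ k.+3 + x ^+ k.+2 + x ^+ k.+1.
  by move=> x3 k; rewrite -[k.+4]/(3 + k.+1)%N exprD x3 !exprS; ring.
pose S k := al ^+ k.+1 * (ga - be) + be ^+ k.+1 * (al - ga)
  + ga ^+ k.+1 * (be - al).
suff TS k : [/\ vandermonde3 * (tribonacci k)%:R = S k,
    vandermonde3 * (tribonacci k.+1)%:R = S k.+1
  & vandermonde3 * (tribonacci k.+2)%:R = S k.+2] by case: (TS n).
elim: k => [|k [T0 T1 T2]].
  split; rewrite /S /vandermonde3 /=; try ring.
  by rewrite al3 be3 ga3; ring.
split=> //; have -> : tribonacci k.+3 =
  (tribonacci k.+2 + tribonacci k.+1 + tribonacci k)%N by [].
by rewrite !natrD !mulrDr T0 T1 T2 /S !step //; ring.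
Qed.


Definition frobenius_fixed := [/\ al ^+ p = al, be ^+ p = be & ga ^+ p = ga].

Hypothesis p2 : p != 2%N.

Let p_pr := pcharf_prime p_char.

Lemma natr_neq0_ndvd (n : nat) : ~~ (p %| n)%N -> n%:R != 0 :> K.
Proof. by rewrite (dvdn_pcharf p_char). Qed.

(** The resolvents [c], [d] satisfy [c * d = 4] and determine the roots. If
    [p = 1 %[mod 3]], Frobenius fixes the roots iff [c ^+ p.-1 = 1]; otherwise it
    fixes them iff it exchanges [c] and [d], that is, [c ^+ p.+1 = 4]. In both
    cases this number is determined by its square and its cube, and the square
    is known as soon as [c] and [d] have the same power. *)
Lemma frobenius_fixed_symbol (w s : K) (psi : nat) : p != 3%N ->
  3.-primitive_root w -> vandermonde3 = - 2 * s -> s ^+ p = s ->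
  (19 + 3 * s * (1 + 2 * w)) ^+ (p.+1 %/ 3) =
    (19 - 3 * s * (1 + 2 * w)) ^+ (p.+1 %/ 3) * w ^+ (p * psi) ->
  frobenius_fixed <-> (3 %| psi)%N.
Proof.
move=> p3 w3 V_eq s_p.
have w0 := omega_eq0 w3; have th2 : w ^+ 2 = - 1 - w.
  by apply/eqP; rewrite -subr_eq0 -[X in _ == X]w0; apply/eqP; ring.
set th := 1 + 2 * w; pose F : {rmorphism K -> K} := pFrobenius_aut p_char.
have FX x : F x = x ^+ p by [].
have Fs : F s = s by rewrite FX.
have n2 : 2 != 0 :> K by apply: (natr_neq0_ndvd (n := 2)); rewrite dvdn_prime2.
have n3 : 3 != 0 :> K by apply: (natr_neq0_ndvd (n := 3)); rewrite dvdn_prime2.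
have th0 : th != 0.
  have th_sq : th ^+ 2 = -3.
    transitivity (4 * (1 + w + w ^+ 2) - 3); first by rewrite /th; ring.
    by rewrite w0 mulr0 add0r.
  by apply: contra_eq_neq th_sq => ->; rewrite expr0n /= eq_sym oppr_eq0.
pose c := al + w * be - (1 + w) * ga; pose d := al + w * ga - (1 + w) * be.
have cd : c * d = 4.
  transitivity ((al + be + ga) ^+ 2 - 3 * (al * be + be * ga + ga * al)
    + (1 + w + w ^+ 2) * (2 * be * ga - be ^+ 2 - ga ^+ 2)).
    by rewrite /c /d; ring.
  by rewrite e1 e2 w0; ring.
have c3 : c ^+ 3 = 19 + 3 * s * th.
  apply: (mulfI n2); rewrite resolvent_cube // -/vandermonde3 e1 e2 e3 V_eq -/th.
  by ring.
have d3 : d ^+ 3 = 19 - 3 * s * th.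
  apply: (mulfI n2); rewrite resolvent_cube //.
  have -> : (al - ga) * (ga - be) * (be - al) = - vandermonde3.
    by rewrite /vandermonde3; ring.
  have -> : al + ga + be = 1 by rewrite -[RHS]e1; ring.
  have -> : al * ga + ga * be + be * al = -1 by rewrite -[RHS]e2; ring.
  have -> : al * ga * be = 1 by rewrite -[RHS]e3; ring.
  by rewrite V_eq -/th; ring.
have n4 : 4 != 0 :> K by rewrite (_ : 4 = 2 ^+ 2) ?expf_neq0 //; ring.
have [c0 d0] : c != 0 /\ d != 0.
  by move: n4; rewrite -cd mulf_eq0 negb_or => /andP[].
rewrite -c3 -d3 -!exprM => cd_e.
have psiE : w ^+ (p * psi) = 1 <-> (3 %| psi)%N.
  rewrite -[(3 %| psi)%N](_ : (w ^+ (p * psi) == 1) = _); first by split=> /eqP.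
  rewrite -(prim_order_dvd w3) Euclid_dvdM // dvdn_prime2 // eq_sym.
  by rewrite (negPf p3).
have cd_w k : c ^+ k = d ^+ k * w ^+ (p * psi) -> c ^+ k = d ^+ k <-> (3 %| psi)%N.
  move=> cdk; rewrite -psiE; split=> [cdk1|wp]; last by rewrite cdk wp mulr1.
  by apply: (mulfI (expf_neq0 k d0)); rewrite -cdk mulr1.
(* The resolvents and [al + be + ga = 1] determine [al], [be + ga] and, as
   [c - d = th * (be - ga)], also [be - ga]. *)
have fix_iff : F c - F d = F th * (be - ga) -> F c + F d = c + d -> frobenius_fixed.
  move=> F1 F2; have F3 : F (al + be + ga) = al + be + ga by rewrite e1 rmorph1.
  have Fth0 : F th != 0 by rewrite fmorph_eq0.
  have F_diff : F be - F ga = be - ga.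
    apply: (mulfI Fth0); rewrite -F1 -!rmorphB -rmorphM; congr (F _).
    by rewrite /c /d /th; ring.
  have F_al : F al = al.
    apply: (mulfI n3); transitivity (F (al + be + ga) + (F c + F d)).
      have <- : F (3 * al) = 3 * F al by rewrite rmorphM rmorph_nat.
      rewrite -!rmorphD; congr (F _).
      by rewrite /c /d; ring.
    by rewrite F2 F3 /c /d; ring.
  have F_sum : F be + F ga = be + ga.
    apply: (addrI (F al)); rewrite {2}F_al addrA addrA -F3 !rmorphD; ring.
  have F_be : F be = be.
    apply: (mulfI n2); transitivity ((F be - F ga) + (F be + F ga)); first by ring.
    by rewrite F_diff F_sum; ring.
  split; rewrite -?FX //.
  by apply: (addrI (F be)); rewrite F_sum F_be.
have Fc3 : F (c ^+ 3) = 19 + 3 * s * F th.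
  by rewrite c3 !(rmorphD, rmorphM, rmorph_nat) Fs.
have p1 := prime_gt1 p_pr.
have [e [e_eq [p_eq|p_eq]]] := prime_mod3 p_pr p3; rewrite e_eq in cd_e.
- have p1E : (3 * e)%N = p.-1 by rewrite p_eq.
  rewrite p1E in cd_e; rewrite -(cd_w _ cd_e).
  have Fw : F w = w by rewrite FX (omega_expr_1mod3 w3 p_eq).
  have Fth : F th = th by rewrite /th !(rmorphD, rmorphM, rmorph1, rmorph_nat) Fw.
  have FE x : F x = x * x ^+ p.-1 by rewrite -exprS prednK // ltnW.
  split=> [[al_p be_p ga_p]|cd_p].
    have Fcd (u v t : K) : u ^+ p = u -> v ^+ p = v -> t ^+ p = t ->
        F (u + w * v - (1 + w) * t) = u + w * v - (1 + w) * t.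
      move=> u_p v_p t_p; rewrite rmorphB rmorphD !rmorphM rmorphD rmorph1 Fw.
      by rewrite !FX u_p v_p t_p.
    have Fc : F c = c by apply: Fcd.
    have Fd : F d = d by apply: Fcd.
    transitivity (1 : K); [apply: (mulfI c0) | apply/esym; apply: (mulfI d0)];
      by rewrite mulr1 -FE.
  have u1 : c ^+ p.-1 = 1.
    have u2 : c ^+ p.-1 * c ^+ p.-1 = 1.
      rewrite {2}cd_p -exprMn cd; apply: (mulfI n4).
      by rewrite mulr1 -FE rmorph_nat.
    have u3 : c ^+ p.-1 ^+ 3 = 1.
      rewrite exprAC; apply: (mulfI (expf_neq0 3 c0)).
      by rewrite mulr1 -FE Fc3 Fth c3.
    transitivity (c ^+ p.-1 * (c ^+ p.-1 * c ^+ p.-1)); first by rewrite u2 mulr1.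
    by rewrite -[RHS]u3; ring.
  apply: fix_iff; rewrite !FE -cd_p u1 !mulr1 // -FE Fth /c /d /th; ring.
rewrite -p_eq in cd_e; rewrite -(cd_w _ cd_e).
have Fw : F w = -1 - w by rewrite FX (omega_expr_2mod3 w3 p_eq).
have Fth : F th = - th.
  by rewrite /th !(rmorphD, rmorphM, rmorph1, rmorph_nat) Fw; ring.
have FE x : x ^+ p.+1 = x * F x by rewrite exprS.
rewrite !FE; split=> [[al_p be_p ga_p]|cd_p].
  have Fcd (u v t : K) : u ^+ p = u -> v ^+ p = v -> t ^+ p = t ->
      F (u + w * v - (1 + w) * t) = u + w * t - (1 + w) * v.
    move=> u_p v_p t_p; rewrite rmorphB rmorphD !rmorphM rmorphD rmorph1 Fw.
    by rewrite !FX u_p v_p t_p; ring.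
  have Fc : F c = d by apply: Fcd.
  have Fd : F d = c by apply: Fcd.
  by rewrite Fc Fd mulrC.
have u1 : c * F c = 4.
  have u2 : (c * F c) ^+ 2 = 16.
    rewrite expr2 {2}cd_p mulrACA -rmorphM cd rmorph_nat; ring.
  have u3 : (c * F c) ^+ 3 = 64.
    rewrite exprMn -rmorphXn Fc3 Fth mulrN -d3 -exprMn cd; ring.
  apply: (mulIf (_ : 16 != 0 :> K)).
    by rewrite (_ : 16 = 4 ^+ 2) ?expf_neq0 //; ring.
  by rewrite -[in LHS]u2 -exprS u3; ring.
have Fc : F c = d by apply: (mulfI c0); rewrite u1 cd.
have Fd : F d = c by apply: (mulfI d0); rewrite -cd_p u1 mulrC cd.
by apply: fix_iff; rewrite Fc Fd ?Fth /c /d /th; ring.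
Qed.

Hypothesis p11 : p != 11%N.

Lemma vandermonde3_neq0 : vandermonde3 != 0.
Proof.
have : (44%:R : K) != 0.
  by apply: natr_neq0_ndvd; rewrite (Euclid_dvdM 4 11) // (Euclid_dvdX 2 2) //
    !dvdn_prime2 // (negPf p2) (negPf p11).
by apply: contraNneq => V0; have := trib_disc; rewrite V0 expr0n /= => /eqP;
  rewrite eq_sym oppr_eq0.
Qed.

Lemma frobenius_root (x : K) : (x - al) * (x - be) * (x - ga) = 0 ->
  (x ^+ p - al) * (x ^+ p - be) * (x ^+ p - ga) = 0.
Proof.
rewrite -!trib_root => x0.
have <- : (x ^+ 3 - x ^+ 2 - x - 1) ^+ p = x ^+ p ^+ 3 - x ^+ p ^+ 2 - x ^+ p - 1.
  rewrite -!(pFrobenius_autE p_char) !rmorphB !rmorphXn /= rmorph1; ring.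
by rewrite x0 expr0n gtn_eqF ?prime_gt0.
Qed.

(** The expression of [tribonacci_roots] is evaluated for each of the six
    permutations of the roots. *)
Lemma trib_dvd_frobenius_fixed : p != 19%N ->
  (p %| tribonacci p.-1)%N <-> frobenius_fixed.
Proof.
move=> p19; rewrite (dvdn_pcharf p_char).
have V0 := vandermonde3_neq0.
rewrite -(inj_eq (mulfI V0)) mulr0 tribonacci_roots prednK ?prime_gt0 //.
split=> [/eqP T0|[-> -> ->]]; last by apply/eqP; ring.
have neq4 : 4 != 0 :> K.
  apply: (natr_neq0_ndvd (n := 4)).
  by rewrite (Euclid_dvdX 2 2) // dvdn_prime2 // (negPf p2).
have ab : al != be.
  by apply: contraNneq V0 => e; rewrite /vandermonde3 e; apply/eqP; ring.
have bc : be != ga.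
  by apply: contraNneq V0 => e; rewrite /vandermonde3 e; apply/eqP; ring.
have ca : ga != al.
  by apply: contraNneq V0 => e; rewrite /vandermonde3 e; apply/eqP; ring.
have cyc : al ^+ 2 + be ^+ 2 + ga ^+ 2 - (al * be + be * ga + ga * al) = 4.
  transitivity ((al + be + ga) ^+ 2 - 3 * (al * be + be * ga + ga * al)).
    by ring.
  by rewrite e1 e2; ring.
have fix_neq (x y z : K) : x + y + z = 1 -> x ^+ 3 - x ^+ 2 - x - 1 = 0 ->
    y != z -> (y - z) * (2 * x - y - z) != 0.
  move=> xyz x0 yz; apply: mulf_neq0; first by rewrite subr_eq0.
  have -> : 2 * x - y - z = 3 * x - 1 by rewrite -[X in _ = _ - X]xyz; ring.
  have : (38%:R : K) != 0.
    apply: natr_neq0_ndvd.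
    by rewrite (Euclid_dvdM 2 19) // !dvdn_prime2 // (negPf p2) (negPf p19).
  apply: contraNneq => x3; apply/eqP.
  (* Division of [27 * f] by [3 * X - 1], with remainder [-38]. *)
  transitivity ((3 * x - 1) * (9 * x ^+ 2 - 6 * x - 11)
     - 27 * (x ^+ 3 - x ^+ 2 - x - 1)); first by ring.
  by rewrite x3 x0; ring.
have root_cases x : (x - al) * (x - be) * (x - ga) = 0 ->
    [\/ x ^+ p = al, x ^+ p = be | x ^+ p = ga].
  move/frobenius_root/eqP; rewrite !mulf_eq0 !subr_eq0 -orbA.
  by case/or3P=> /eqP ->; [apply: Or31 | apply: Or32 | apply: Or33].
have inj (x y z : K) : x ^+ p = z -> y ^+ p = z -> x = y.
  move=> <- /esym; rewrite -!(pFrobenius_autE p_char); exact: fmorph_inj.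
have ral : (al - al) * (al - be) * (al - ga) = 0 by ring.
have rbe : (be - al) * (be - be) * (be - ga) = 0 by ring.
have rga : (ga - al) * (ga - be) * (ga - ga) = 0 by ring.
have al0 := etrans (trib_root al) ral; have be0 := etrans (trib_root be) rbe.
have ga0 := etrans (trib_root ga) rga.
have [alp|alp|alp] := root_cases al ral; have [bep|bep|bep] := root_cases be rbe;
  have [gap|gap|gap] := root_cases ga rga;
  try (by case/eqP: ab; apply: inj alp bep);
  try (by case/eqP: bc; apply: inj bep gap);
  try (by case/eqP: ca; apply: inj gap alp); first by [].
all: move: T0; rewrite alp bep gap => T0.
- have /eqP[] : (ga - be) * (2 * al - ga - be) != 0.
    by apply: fix_neq al0 _; [rewrite -[RHS]e1; ring | rewrite eq_sym].
  by rewrite -[RHS]T0; ring.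
- have /eqP[] : (be - al) * (2 * ga - be - al) != 0.
    by apply: fix_neq ga0 _; [rewrite -[RHS]e1; ring | rewrite eq_sym].
  by rewrite -[RHS]T0; ring.
- by case/eqP: neq4; rewrite -cyc -[RHS]oppr0 -[in RHS]T0; ring.
- by case/eqP: neq4; rewrite -cyc -[RHS]T0; ring.
- have /eqP[] : (al - ga) * (2 * be - al - ga) != 0.
    by apply: fix_neq be0 _; [rewrite -[RHS]e1; ring | rewrite eq_sym].
  by rewrite -[RHS]T0; ring.
Qed.

End Cubic.

(** * Primes dividing the Tribonacci number *)

(** A root [al] of the cubic, then a root [be] of the quotient by [X - al]. *)
Lemma trib_roots_exist (K : closedFieldType) : exists al be ga : K,
  [/\ al + be + ga = 1, al * be + be * ga + ga * al = -1 & al * be * ga = 1].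
Proof.
have /closed_rootP[al] : size ('X^3 + \poly_(i < 3) (-1) : {poly K}) != 1%N.
  rewrite size_polyDl size_polyXn // (leq_ltn_trans (size_poly _ _)) //.
rewrite /root hornerD hornerXn horner_poly !big_ord_recr big_ord0 /= => /eqP al0.
pose q : {poly K} := 'X^2 + ((al - 1) *: 'X + (al ^+ 2 - al - 1)%:P).
have /closed_rootP[be] : size q != 1%N.
  rewrite /q size_polyDl size_polyXn // (leq_ltn_trans (size_polyD _ _)) //.
  rewrite gtn_max (leq_ltn_trans (size_scale_leq _ _)) ?size_polyX //.
  by rewrite (leq_ltn_trans (size_polyC_leq1 _)).
rewrite /root /q !(hornerD, hornerZ, hornerXn, hornerX, hornerC) => /eqP be0.
exists al, be, (1 - al - be); split; first by ring.
  transitivity (- (be ^+ 2 + ((al - 1) * be + (al ^+ 2 - al - 1))) - 1).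
    by ring.
  by rewrite be0; ring.
transitivity (- al * (be ^+ 2 + ((al - 1) * be + (al ^+ 2 - al - 1)))
  + (al ^+ 3 + (0 + -1 * al ^+ 0 + -1 * al ^+ 1 + -1 * al ^+ 2)) + 1).
  by ring.
by rewrite be0 al0; ring.
Qed.

(** The polynomial [X^p - X] has no more than [p] roots. *)
Lemma frobenius_fixed_natr (K : fieldType) (p : nat) (x : K) :
  p \in [pchar K] -> x ^+ p = x -> exists h : nat, x = h%:R.
Proof.
move=> p_char x_p; have p_pr := pcharf_prime p_char; have p1 := prime_gt1 p_pr.
pose s := [seq h%:R : K | h <- iota 0 p].
suff /mapP[h _ ->] : x \in s by exists h.
apply: contraT => x_s.
have size_q : size ('X^p - 'X : {poly K}) = p.+1.
  by rewrite size_polyDl size_polyXn // size_polyN size_polyX.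
have := @max_poly_roots _ ('X^p - 'X : {poly K}) (x :: s).
rewrite size_q /= size_map size_iota ltnn; apply.
- by rewrite -size_poly_gt0 size_q.
- rewrite /root !(hornerD, hornerN, hornerXn, hornerX) x_p subrr eqxx /=.
  apply/allP=> _ /mapP[h _ ->].
  rewrite /root !(hornerD, hornerN, hornerXn, hornerX).
  by rewrite -(pFrobenius_autE p_char) rmorph_nat subrr.
rewrite x_s map_inj_in_uniq ?iota_uniq // => i j; rewrite !mem_iota /= add0n.
wlog ij : i j / (i <= j)%N => [hwlog i_lt j_lt ij_eq|i_lt j_lt ij_eq].
  by case: (leqP i j) => [|/ltnW] le; [|apply/esym]; apply: hwlog.
have : (p %| j - i)%N by rewrite (dvdn_pcharf p_char) natrB // ij_eq subrr.
by move=> /dvdnP[[|t]]; lia.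
Qed.

(** Exchanging [be] and [ga] changes the sign of the Vandermonde product, so it
    can be matched with either square root of -11. *)
Lemma frobenius_fixed_iff (K : closedFieldType) (p : nat) (al be ga : K)
    (x y : int) :
  p \in [pchar K] -> p != 2%N -> p != 3%N -> p != 11%N ->
  al + be + ga = 1 -> al * be + be * ga + ga * al = -1 -> al * be * ga = 1 ->
  4 * p%:Z = x ^+ 2 + 11 * y ^+ 2 ->
  frobenius_fixed p al be ga <-> (2 %| y)%Z.
Proof.
move=> p_char p2 p3 p11 e1 e2 e3 xy; have p_pr := pcharf_prime p_char.
have [psi [<- psi_K]] := norm_form_symbol p_pr p2 p3 p11 xy.
have [w w3] : exists w : K, 3.-primitive_root w.
  by apply: closed_exists_prim_root => //; rewrite -(dvdn_pcharf p_char) dvdn_prime2.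
have [s [s2 s_p s_eq]] := psi_K K w p_char w3.
have : (vandermonde3 al be ga - 2 * s) * (vandermonde3 al be ga + 2 * s) = 0.
  transitivity (vandermonde3 al be ga ^+ 2 - 4 * s ^+ 2); first by ring.
  by rewrite (trib_disc e1 e2 e3) s2; ring.
move/eqP; rewrite mulf_eq0 subr_eq0 addr_eq0 => /orP[] /eqP V_eq; last first.
  rewrite -mulNr in V_eq.
  exact: (frobenius_fixed_symbol p_char e1 e2 e3 p2 p3 w3 V_eq s_p s_eq).
have V_eq' : vandermonde3 al ga be = - 2 * s.
  by rewrite mulNr -V_eq /vandermonde3; ring.
have f1 : al + ga + be = 1 by rewrite -[RHS]e1; ring.
have f2 : al * ga + ga * be + be * al = -1 by rewrite -[RHS]e2; ring.
have f3 : al * ga * be = 1 by rewrite -[RHS]e3; ring.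
rewrite -(frobenius_fixed_symbol p_char f1 f2 f3 p2 p3 w3 V_eq' s_p s_eq).
by split; case.
Qed.

(** Frobenius also fixes half of the Vandermonde product, a square root of -11.
    Lifting it to an odd integer [k] makes [k^2 + 11] divisible by [4 p]. *)
Lemma frobenius_fixed_norm_form (K : closedFieldType) (p : nat) (al be ga : K) :
  p \in [pchar K] -> p != 2%N ->
  al + be + ga = 1 -> al * be + be * ga + ga * al = -1 -> al * be * ga = 1 ->
  frobenius_fixed p al be ga -> exists x y : int, 4 * p%:Z = x ^+ 2 + 11 * y ^+ 2.
Proof.
move=> p_char p2 e1 e2 e3 [al_p be_p ga_p]; have p_pr := pcharf_prime p_char.
have p_odd : odd p by case: (even_prime p_pr) p2 => // ->.
have n2 : 2 != 0 :> K by rewrite -(dvdn_pcharf p_char 2) dvdn_prime2.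
pose F : {rmorphism K -> K} := pFrobenius_aut p_char.
have [h h_eq] : exists h : nat, vandermonde3 al be ga / 2 = h%:R.
  apply: (frobenius_fixed_natr p_char).
  change (F (vandermonde3 al be ga / 2) = vandermonde3 al be ga / 2).
  rewrite fmorph_div /vandermonde3 !rmorphM !rmorphB rmorph_nat.
  by have [-> -> ->] : [/\ F al = al, F be = be & F ga = ga].
have h_dvd : (p %| h ^ 2 + 11)%N.
  rewrite (dvdn_pcharf p_char) natrD natrX -h_eq; apply/eqP.
  apply: (mulIf (expf_neq0 2 n2)); rewrite mul0r mulrDl -exprMn divfK //.
  by rewrite (trib_disc e1 e2 e3); ring.
have [k k_odd k_dvd] : exists2 k, odd k & (p %| k ^ 2 + 11)%N.
  case: (boolP (odd h)) => h_odd; first by exists h.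
  exists (h + p)%N; first by rewrite oddD (negPf h_odd) p_odd.
  have -> : ((h + p) ^ 2 + 11 = h ^ 2 + 11 + (p + 2 * h) * p)%N.
    by rewrite sqrnD -!mulnn mulnDl; lia.
  by rewrite dvdn_addr ?dvdn_mull.
apply: (@norm_form11 _ k); first by rewrite ltz_nat prime_gt0.
have -> : k%:Z ^+ 2 + 11 = (k ^ 2 + 11)%N by rewrite PoszD -mulnn PoszM expr2.
have -> : 4 * p%:Z = (4 * p)%N by [].
rewrite dvdzE /= Gauss_dvd.
  2: by rewrite (coprimeXl 2 (_ : coprime 2 p)) // coprime2n.
rewrite k_dvd andbT -[k]odd_double_half k_odd -mulnn -muln2.
by apply/dvdnP; exists (k./2 * k./2 + k./2 + 3)%N; clear; lia.
Qed.

Local Close Scope ring_scope.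

Theorem theorem1p1 (p : nat) (p_prime : prime p)
    (p_neq11 : p <> 11) (p_neq19 : p <> 19) :
  p %| tribonacci (p - 1) <->
  exists x y : int, (p%:Z = x ^+ 2 + 11 * y ^+ 2)%R.
Proof.
have small (q : nat) : q = 2 \/ q = 3 -> ~ exists x y : int,
    (q%:Z = x ^+ 2 + 11 * y ^+ 2)%R.
  move=> q_eq [x [y xy]]; have x2 := sqr_ge0 x; have y2 := sqr_ge0 y.
  have y0 : (y ^+ 2 = 0)%R by lia.
  have : (`|x| ^ 2 = q)%N.
    apply/eqP; rewrite -eqz_nat -mulnn PoszM !abszE -expr2 real_normK ?num_real //.
    by rewrite xy y0 mulr0 addr0.
  case: `|x|%N => [|[|t]]; rewrite -mulnn; lia.
have [->|/eqP p2] := eqVneq p 2; first by split=> // /small; case; left.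
have [->|/eqP p3] := eqVneq p 3; first by split=> // /small; case; right.
move: p2 p3 p_neq11 p_neq19 => /eqP p2 /eqP p3 /eqP p11 /eqP p19.
have [K p_char] := algebraic_closure_Fp p_prime.
have [al [be [ga [e1 e2 e3]]]] := trib_roots_exist K.
rewrite subn1 (trib_dvd_frobenius_fixed p_char e1 e2 e3 p2 p11 p19).
split=> [fixed|[x [y xy]]].
  have [x [y xy]] := frobenius_fixed_norm_form p_char p2 e1 e2 e3 fixed.
  have /dvdzP[v y_eq] := (frobenius_fixed_iff p_char p2 p3 p11 e1 e2 e3 xy).1 fixed.
  have /dvdzP[u x_eq] : (2 %| x)%Z.
    have : (2 %| (x ^+ 2)%R)%Z.
      apply/dvdzP; exists (2 * p%:Z - 22 * v ^+ 2)%R.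
      by rewrite mulrBl [(2 * _ * 2)%R]mulrAC xy y_eq; ring.
    by rewrite !dvdzE abszX Euclid_dvdX // => /andP[].
  exists u, v; apply: (mulfI (isT : 4%:Z != 0)%R).
  by rewrite xy x_eq y_eq; ring.
have xy4 : (4 * p%:Z = (2 * x) ^+ 2 + 11 * (2 * y) ^+ 2)%R by rewrite xy; ring.
apply: (frobenius_fixed_iff p_char p2 p3 p11 e1 e2 e3 xy4).2.
exact: dvdz_mulr.
Qed.
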